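(* For every dimension $d\ge 1$, the problem of determining whether a given $d$-dimensional cellular automaton is nilpotent on finite configurations is $\Pi^0_2$-complete. That is, the set of (codes of) $d$-dimensional cellular automata that are nilpotent on finite configurations belongs to $\Pi^0_2$, and every $\Pi^0_2$ set of natural numbers is many-one reducible to it.
   Context: A cellular automaton is a quadruple $(d,S,N,f)$ where $d$ is the dimension, $S$ is a finite set of states, $N\subset\mathbb{Z}^d$ is a finite set (the neighborhood), and $f:S^N\to S$ is the local transition function. It induces the global function $G:S^{\mathbb{Z}^d}\to S^{\mathbb{Z}^d}$, $G(x)_v=f\big((x_{v+n})_{n\in N}\big)$. As the inputs of a decision problem, cellular automata are finite objects (e.g. with $S=\{0,\dots,k-1\}$) coded by natural numbers in a standard computable way. The state set contains a distinguished quiescent (blank) state $0$, with $f(0,\dots,0)=0$. A configuration $c\in S^{\mathbb{Z}^d}$ is finite if $c_v\ne 0$ for only finitely many $v\in\mathbb{Z}^d$. The automaton $G$ is nilpotent on finite configurations if for every finite configuration $c$ there exists $n\in\mathbb{N}$ such that $G^n(c)$ is the all-$0$ configuration. $\Pi^0_2$ refers to the arithmetical hierarchy of subsets of $\mathbb{N}$; completeness is with respect to computable many-one reductions. *)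

(* Defs.v *)
From HB Require Import structures.
From mathcomp Require Import all_boot all_order all_algebra.
From mathcomp Require Import boolp classical_sets cardinality.

Set Implicit Arguments.
Unset Strict Implicit.
Unset Printing Implicit Defensive.

Import GRing.Theory.
Local Open Scope classical_set_scope.

(* Kleene's partial recursive functions, with relational semantics.          *)
(* [rec_prim f g] recurses on the first argument:                            *)
(*   h(0, x) = f(x),  h(k+1, x) = g(k, h(k, x), x);                          *)
(* [rec_mu f] sends x to the least y with f(y, x) = 0, all the values        *)
(* f(z, x) for z < y being defined.                                          *)
Inductive recfun : nat -> Type :=
| rec_zero n : recfun n
| rec_succ : recfun 1
| rec_proj n (i : 'I_n) : recfun n
| rec_comp m n (f : recfun m) (g : 'I_m -> recfun n) : recfun n
| rec_prim n (f : recfun n) (g : recfun n.+2) : recfun n.+1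
| rec_mu n (f : recfun n.+1) : recfun n.

Fixpoint computes n (e : recfun n) : n.-tuple nat -> nat -> Prop :=
  match e in recfun n return n.-tuple nat -> nat -> Prop with
  | rec_zero _ => fun _ y => y = 0
  | rec_succ => fun x y => y = (thead x).+1
  | rec_proj _ i => fun x y => y = tnth x i
  | rec_comp m _ f g => fun x y =>
      exists2 v : m.-tuple nat,
        forall i, computes (g i) x (tnth v i) & computes f v y
  | rec_prim _ f g => fun x =>
      (fix iterate (k : nat) : nat -> Prop :=
        match k with
        | 0 => fun y => computes f (behead_tuple x) y
        | k'.+1 => fun y => exists2 z, iterate k' z
            & computes g (cons_tuple k' (cons_tuple z (behead_tuple x))) y
        end) (thead x)
  | rec_mu _ f => fun x y =>
      computes f (cons_tuple y x) 0 /\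
      forall z, z < y -> exists w, computes f (cons_tuple z x) w.+1
  end.

Lemma computes_functional n (e : recfun n) x y y' :
  computes e x y -> computes e x y' -> y = y'.
Proof.
elim: e x y y' => {n} /= [n||n i|m n f IHf g IHg|n f IHf g IHg|n f IHf] x y y'.
- by move=> -> ->.
- by move=> -> ->.
- by move=> -> ->.
- move=> [v gv fv] [v' gv' fv']; suff vv' : v = v' by subst v'; exact: IHf fv fv'.
  by apply: eq_from_tnth => i; exact: IHg (gv i) (gv' i).
- elim: (thead x) y y' => [|k IHk] y y'; first exact: IHf.
  move=> [z kz gz] [z' kz' gz']; have zz' := IHk _ _ kz kz'.
  by subst z'; exact: IHg gz gz'.
- move=> [fy y_min] [fy' y'_min]; case: (ltngtP y y') => // [/y'_min|/y_min] [w fw].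
  + by have := IHf _ _ _ fy fw.
  + by have := IHf _ _ _ fy' fw.
Qed.

Definition computable n (F : n.-tuple nat -> nat) : Prop :=
  exists e : recfun n, forall x, computes e x (F x).

Definition computable_fun (f : nat -> nat) : Prop :=
  computable (fun x : 1.-tuple nat => f (thead x)).

Definition computable_rel3 (R : nat -> nat -> nat -> bool) : Prop :=
  computable (fun x : 3.-tuple nat =>
    nat_of_bool (R (tnth x 0%R) (tnth x 1%R) (tnth x 2%R))).

Definition Pi02 (A : set nat) : Prop :=
  exists2 R : nat -> nat -> nat -> bool, computable_rel3 R
    & forall x, A x <-> forall y, exists z, R x y z.

Definition many_one_reducible (A B : set nat) : Prop :=
  exists2 f : nat -> nat, computable_fun f & forall x, A x <-> B (f x).

Definition Pi02_complete (B : set nat) : Prop :=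
  Pi02 B /\ forall A : set nat, Pi02 A -> many_one_reducible A B.

(* The states are 0, ..., ca_top, so ca_top + 1 is their number, and the     *)
(* state 0 is the quiescent one. The neighborhood, a finite subset of Z^d,   *)
(* is presented by a duplicate-free list, and the local rule is a function   *)
(* S^N -> S.                                                                 *)
Record cellular_automaton (d : nat) := CellularAutomaton {
  ca_top : nat;
  ca_nbhd : seq 'rV[int]_d;
  ca_rule : {ffun {ffun seq_sub ca_nbhd -> 'I_ca_top.+1} -> 'I_ca_top.+1};
  ca_nbhd_uniq : uniq ca_nbhd;
  ca_quiescent : ca_rule [ffun=> ord0] = ord0 }.

Section CellularAutomata.
Variables (d : nat) (A : cellular_automaton d).

Definition ca_state : Type := 'I_(ca_top A).+1.

Definition configuration : Type := 'rV[int]_d -> ca_state.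

Definition ca_global (c : configuration) : configuration :=
  fun v => ca_rule A [ffun n : seq_sub (ca_nbhd A) => c (v + val n)%R].

Definition finite_configuration (c : configuration) : Prop :=
  finite_set [set v | c v <> ord0].

Definition nilpotent_on_finite : Prop :=
  forall c, finite_configuration c ->
    exists n, forall v, iter n ca_global c v = ord0.

(* The local pattern in which the i-th listed neighbor (from i = 0) carries  *)
(* the i-th digit of j in base |S|; every pattern arises from exactly one    *)
(* j < |S| ^ |N|.                                                            *)
Definition pattern_of_nat (j : nat) : {ffun seq_sub (ca_nbhd A) -> ca_state} :=
  [ffun n => inord ((j %/ (ca_top A).+1 ^ index (val n) (ca_nbhd A))
                      %% (ca_top A).+1)].

Definition rule_table : seq nat :=
  [seq nat_of_ord (ca_rule A (pattern_of_nat j))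
     | j <- iota 0 ((ca_top A).+1 ^ size (ca_nbhd A))].

End CellularAutomata.

Definition int_code (z : int) : nat :=
  match z with Posz n => n.*2 | Negz n => n.*2.+1 end.

Definition vector_code d (v : 'rV[int]_d) : nat :=
  CodeSeq.code [seq int_code (v ord0 i) | i <- enum 'I_d].

(* [CodeSeq.code] is a computable bijection from seq nat to nat.             *)
Definition ca_code d (A : cellular_automaton d) : nat :=
  CodeSeq.code [:: (ca_top A).+1;
                   CodeSeq.code [seq vector_code v | v <- ca_nbhd A];
                   CodeSeq.code (rule_table A)].

Lemma int_code_inj : injective int_code.
Proof.
move=> [m|m] [n|n] /= e.
- by rewrite (double_inj e).
- by have := congr1 odd e; rewrite /= !odd_double.
- by have := congr1 odd e; rewrite /= !odd_double.
- by case: e => /double_inj ->.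
Qed.

Lemma vector_code_inj d : injective (@vector_code d).
Proof.
move=> u v /(can_inj CodeSeq.codeK)/eq_in_map e.
apply/rowP => i; apply: int_code_inj; apply: e; exact: mem_enum.
Qed.

Lemma pattern_of_nat_surj d (A : cellular_automaton d) p :
  exists2 j, j < (ca_top A).+1 ^ size (ca_nbhd A) & pattern_of_nat A j = p.
Proof.
set b := (ca_top A).+1; set N := ca_nbhd A.
have digits (s : seq nat) : all (fun q => q < b) s ->
    exists2 j, j < b ^ size s & forall i, i < size s ->
      (j %/ b ^ i) %% b = nth 0 s i.
  elim: s => [_|q s IHs /= /andP[qb /IHs[j jb js]]]; first by exists 0.
  exists (j * b + q).
    rewrite expnS mulnC (@leq_trans (j.+1 * b)) //; last first.
      by rewrite mulnC leq_mul2l jb orbT.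
    by rewrite mulSn addnC (mulnC b) ltn_add2r.
  case=> [_|i] /=; last move=> /js <-; first by rewrite expn0 divn1 modnMDl modn_small.
  by rewrite expnS divnMA divnMDl // (divn_small qb) addn0.
pose s := [seq (if insub v is Some n then nat_of_ord (p n) else 0) | v <- N].
have [|j jb js] := digits s.
  by apply/allP => _ /mapP[v _ ->]; case: insub => // n; apply: ltn_ord.
exists j; first by rewrite size_map in jb.
apply/ffunP => n; apply: val_inj; rewrite ffunE /= inordK ?ltn_mod //.
have nN : index (val n) N < size N by rewrite index_mem (valP n).
rewrite js ?size_map // (nth_map (val n)) // nth_index ?(valP n) //.
by rewrite valK.
Qed.

Lemma ca_code_inj d : injective (@ca_code d).
Proof.
move=> A B /(can_inj CodeSeq.codeK)[].
move=> + /(can_inj CodeSeq.codeK)/(inj_map (@vector_code_inj d)).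
move=> + + /(can_inj CodeSeq.codeK).
case: A B => [k N f Nu f0] [k' N' f' Nu' f0'] /= ek eN; subst k' N'.
set A := CellularAutomaton Nu f0; set B := CellularAutomaton Nu' f0'.
move=> /eq_in_map e; have ff' : f = f'.
  apply/ffunP => p; have [j jb <-] := @pattern_of_nat_surj d A p.
  by apply: val_inj; apply: e; rewrite mem_iota.
subst f'; rewrite /A /B; congr CellularAutomaton; exact: Prop_irrelevance.
Qed.

Definition nilpotent_ca_codes (d : nat) : set nat :=
  [set m | exists2 A : cellular_automaton d,
             ca_code A = m & nilpotent_on_finite A].

(* Main.v *)
(* Membership: [m] is the code of an automaton that is nilpotent on finite    *)
(* configurations iff it is the code of some automaton and for every finite   *)
(* configuration [y] there is a list [z] of successive configurations leading *)
(* from [y] to zero; that [z] is such a list is decidable, because a step     *)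
(* moves the support by a bounded amount.                                     *)
(*                                                                            *)
(* Hardness: let [x \in A] iff for all [y] there is [z] with [R x y z]. A     *)
(* register machine, simulated by a head sweeping over a word of cells,       *)
(* searches for [z], and the whole word dies when the search succeeds. Since  *)
(* an initial configuration may contain a machine in an arbitrary state, the  *)
(* machine carries a timer; when it runs out, the machine is restarted on the *)
(* inputs [x] and [y], with a larger timer. The input [y] is written on the   *)
(* word and never changes, whereas [x] is only visible in the neighborhood:   *)
(* a cell looks at the cell [x + 3] positions to its left, and so it learns   *)
(* its distance to the origin of the word. Hence the table of the local rule  *)
(* does not depend on [x]. Inconsistent words collapse, starting from the     *)
(* inconsistency, so that an origin that survives belongs to a sound word.    *)
(* A cell may mistake an origin further to the left for its own, but not in   *)
(* the word of the leftmost surviving origin. Therefore all origins die if    *)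
(* [x \in A], after which the remaining cells are erased from the left at     *)
(* speed two while they spread to the right at speed at most one. In          *)
(* dimension [d], each line parallel to the first axis evolves on its own.    *)

(* Membership: a step of the automaton enlarges the support in a computable way, so the death of a
   finite configuration has a finite certificate whose validity is decidable. [death_code_sound] and
   [death_code_complete] relate certificates to the dynamics, [valid_code_surj] recognizes codes of
   automata, and the [cmp] calculus proves [nilpotency_rel] computable.

   Hardness: [search_program] gives a register program that halts on [(x, y)] iff some [z] satisfies
   [R x y z]. The difficulty is that nilpotency quantifies over all finite configurations, including
   machines in states that no computation reaches. By [word_halts] these do no harm: a well-formed
   word, whatever its contents, goes back again and again to reloading its true inputs, with its
   growing length as timer, so if the program halts for every [y] some run has enough time.
   Conversely, by [word_survives], a single [y] on which the program diverges gives an immortal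
   word.

   On a line, a leftmost origin that never died would always be the origin of a sound word,
   contradicting [word_halts]. Hence origins die from left to right ([origin_dies],
   [all_origins_die]), and the cells left over are eroded ([supported_orphans], [line_dies]).
   [line_survives] is the converse. The number [x] enters the automaton only as an offset of its
   neighborhood, so the reduction is computable ([automaton_code_computable]). *)
From HB Require Import structures.
Require Import Defs.
From mathcomp Require Import all_boot all_order all_algebra.
From mathcomp Require Import boolp classical_sets cardinality.
From mathcomp Require Import zify.

Set Implicit Arguments.
Unset Strict Implicit.
Unset Printing Implicit Defensive.

Import GRing.Theory.

(** * Computable functions of an environment *)

(* Environments are infinite sequences, so that weakening under a binder is  *)
(* definitional: the outer variable [rho i] becomes [rho i.+1].              *)
Definition scons (k : nat) (rho : nat -> nat) : nat -> nat :=
  fun i => if i is i'.+1 then rho i' else k.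

Definition env_tuple n (rho : nat -> nat) : n.-tuple nat :=
  [tuple rho i | i < n].

Definition cmp n (F : (nat -> nat) -> nat) : Prop :=
  exists e : recfun n, forall rho, computes e (env_tuple n rho) (F rho).

Definition cmpb n (B : (nat -> nat) -> bool) : Prop :=
  cmp n (fun rho => B rho : nat).

Lemma tnth_env n rho (i : 'I_n) : tnth (env_tuple n rho) i = rho i.
Proof. by rewrite tnth_mktuple. Qed.

Lemma env_scons n k rho :
  env_tuple n.+1 (scons k rho) = cons_tuple k (env_tuple n rho).
Proof.
apply: eq_from_tnth => i; rewrite tnth_env.
by case: (unliftP ord0 i) => [j|] -> //=; rewrite tnthS tnth_env.
Qed.

Lemma behead_env n rho :
  behead_tuple (env_tuple n.+1 rho) = env_tuple n (fun i => rho i.+1).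
Proof.
apply: eq_from_tnth => i; rewrite tnth_behead !tnth_env /=.
by rewrite inordK // ltnS.
Qed.

Lemma thead_env n rho : thead (env_tuple n.+1 rho) = rho 0.
Proof. by rewrite /thead tnth_env. Qed.

Lemma eq_cmp n F G : F =1 G -> cmp n F -> cmp n G.
Proof. by move=> FG [e eF]; exists e => rho; rewrite -FG. Qed.

Lemma cmp_var n i : i < n -> cmp n (fun rho => rho i).
Proof. by move=> lin; exists (rec_proj (Ordinal lin)) => rho /=;
  rewrite tnth_env. Qed.

Lemma cmp_comp n m (F : (nat -> nat) -> nat) (G : nat -> (nat -> nat) -> nat) :
  cmp m F -> (forall i, i < m -> cmp n (G i)) ->
  cmp n (fun rho => F (fun i => G i rho)).
Proof.
move=> [e eF] cG.
have [g gG] : exists g : 'I_m -> recfun n, forall (i : 'I_m) rho,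
    computes (g i) (env_tuple n rho) (G i rho).
  have /boolp.choice[g gG] : forall i : 'I_m, exists g : recfun n, forall rho,
    computes g (env_tuple n rho) (G i rho) by move=> i; apply: cG.
  by exists g.
exists (rec_comp e g) => rho /=.
exists (env_tuple m (fun i => G i rho)) => [i|]; last exact: eF.
by rewrite tnth_env.
Qed.

Lemma cmp1 n f F : cmp 1 (fun rho => f (rho 0)) -> cmp n F ->
  cmp n (fun rho => f (F rho)).
Proof. by move=> cf cF; apply: (cmp_comp (G := fun=> F) cf). Qed.

Lemma cmp2 n f F G : cmp 2 (fun rho => f (rho 0) (rho 1)) -> cmp n F ->
  cmp n G -> cmp n (fun rho => f (F rho) (G rho)).
Proof.
move=> cf cF cG.
by apply: (cmp_comp (G := fun i => if i is 0 then F else G) cf) => -[].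
Qed.

Lemma cmp_S n F : cmp n F -> cmp n (fun rho => (F rho).+1).
Proof. by apply: cmp1; exists rec_succ => rho /=; rewrite thead_env. Qed.

Lemma cmp_const n c : cmp n (fun=> c).
Proof. by elim: c => [|c IHc]; [exists (rec_zero n) | exact: cmp_S]. Qed.

(** [rec_prim] recurses on its first argument, so the bound is made variable 0 of an auxiliary
    function [H], into which [N] is then substituted. *)
Lemma cmp_rec n (N F : (nat -> nat) -> nat)
    (G : nat -> nat -> (nat -> nat) -> nat) :
  cmp n N -> cmp n F ->
  cmp n.+2 (fun rho => G (rho 0) (rho 1) (fun i => rho i.+2)) ->
  cmp n (fun rho => nat_rect (fun=> nat) (F rho) (fun k z => G k z rho) (N
    rho)).
Proof.
move=> cN [eF cF] [eG cG].
pose H rho := nat_rect (fun=> nat) (F (fun i => rho i.+1))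
  (fun k z => G k z (fun i => rho i.+1)) (rho 0).
have cH : cmp n.+1 H.
  exists (rec_prim eF eG) => rho /=; rewrite thead_env behead_env /H.
  elim: (rho 0) => [|k IHk] /=; first exact: cF.
  by eexists; [exact: IHk | rewrite -!env_scons; exact: cG].
apply: (cmp_comp (G := fun i => if i is i'.+1 then fun rho => rho i' else N)
  cH).
by case=> // i; rewrite ltnS; apply: cmp_var.
Qed.

Lemma cmp_add n F G : cmp n F -> cmp n G -> cmp n (fun rho => F rho + G rho).
Proof.
apply: cmp2; apply: eq_cmp (cmp_rec (N := fun rho => rho 1)
  (F := fun rho => rho 0) (G := fun k z rho => z.+1) _ _ _).
- by move=> rho /=; elim: (rho 1) => [|k IHk] /=; rewrite ?addn0 ?IHk ?addnS.
- exact: cmp_var.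
- exact: cmp_var.
- by apply: cmp_S; apply: cmp_var.
Qed.

Lemma cmp_pred n F : cmp n F -> cmp n (fun rho => (F rho).-1).
Proof.
apply: cmp1; apply: eq_cmp (cmp_rec (N := fun rho => rho 0)
  (F := fun=> 0) (G := fun k z rho => k) _ _ _).
- by move=> rho /=; case: (rho 0).
- exact: cmp_var.
- exact: cmp_const.
- exact: cmp_var.
Qed.

Lemma cmp_sub n F G : cmp n F -> cmp n G -> cmp n (fun rho => F rho - G rho).
Proof.
apply: cmp2; apply: eq_cmp (cmp_rec (N := fun rho => rho 1)
  (F := fun rho => rho 0) (G := fun k z rho => z.-1) _ _ _).
- by move=> rho /=; elim: (rho 1) => [|k IHk] /=; rewrite ?subn0 ?IHk ?subnS.
- exact: cmp_var.
- exact: cmp_var.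
- by apply: cmp_pred; apply: cmp_var.
Qed.

Lemma cmp_mul n F G : cmp n F -> cmp n G -> cmp n (fun rho => F rho * G rho).
Proof.
apply: cmp2; apply: eq_cmp (cmp_rec (N := fun rho => rho 1)
  (F := fun rho => 0) (G := fun k z rho => rho 0 + z) _ _ _).
- by move=> rho /=; elim: (rho 1) => [|k IHk] /=; rewrite ?muln0 ?IHk ?mulnS.
- exact: cmp_var.
- exact: cmp_const.
- by apply: cmp_add; apply: cmp_var.
Qed.

Lemma cmp_exp n F G : cmp n F -> cmp n G -> cmp n (fun rho => F rho ^ G rho).
Proof.
apply: cmp2; apply: eq_cmp (cmp_rec (N := fun rho => rho 1)
  (F := fun rho => 1) (G := fun k z rho => rho 0 * z) _ _ _).
- by move=> rho /=; elim: (rho 1) => [|k IHk] /=; rewrite ?IHk ?expnS.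
- exact: cmp_var.
- exact: cmp_const.
- by apply: cmp_mul; apply: cmp_var.
Qed.

Lemma cmp_double n F : cmp n F -> cmp n (fun rho => (F rho).*2).
Proof.
by move=> cF; apply: eq_cmp (cmp_add cF cF) => rho; rewrite addnn.
Qed.

Lemma cmp_sum n N B : cmp n N ->
  cmp n.+1 (fun rho => B (rho 0) (fun i => rho i.+1)) ->
  cmp n (fun rho => \sum_(i < N rho) B i rho).
Proof.
move=> cN cB; apply: eq_cmp (cmp_rec (N := N) (F := fun=> 0)
  (G := fun k z rho => z + B k rho) _ _ _) => //.
- move=> rho /=; elim: (N rho) => [|k IHk] /=; first by rewrite big_ord0.
  by rewrite big_ord_recr IHk.
- exact: cmp_const.
- apply: cmp_add; first exact: cmp_var.
  by apply: (cmp_comp (G := fun i => if i is i'.+1 then fun rho => rho i'.+2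
     else fun rho => rho 0) cB) => -[|i] li; apply: cmp_var.
Qed.

Lemma cmp_sum_nat n N B : cmp n N ->
  cmp n.+1 (fun rho => B (rho 0) (fun i => rho i.+1)) ->
  cmp n (fun rho => \sum_(0 <= i < N rho) B i rho).
Proof.
by move=> cN cB; apply: eq_cmp (cmp_sum cN cB) => rho; rewrite big_mkord.
Qed.

Lemma cmpb_not n B : cmpb n B -> cmpb n (fun rho => ~~ B rho).
Proof.
move=> cB; apply: eq_cmp (cmp_sub (cmp_const n 1) cB) => rho.
by case: (B rho).
Qed.

Lemma cmpb_and n B C : cmpb n B -> cmpb n C ->
  cmpb n (fun rho => B rho && C rho).
Proof.
by move=> cB cC; apply: eq_cmp (cmp_mul cB cC) => rho; rewrite mulnb.
Qed.

Lemma cmpb_imply n B C : cmpb n B -> cmpb n C ->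
  cmpb n (fun rho => B rho ==> C rho).
Proof.
move=> cB cC; apply: eq_cmp (cmpb_not (cmpb_and cB (cmpb_not cC))) => rho.
by case: (B rho); case: (C rho).
Qed.

Lemma cmpb_leq n F G : cmp n F -> cmp n G ->
  cmpb n (fun rho => F rho <= G rho).
Proof.
move=> cF cG; apply: eq_cmp (cmp_sub (cmp_const n 1) (cmp_sub cF cG)) => rho.
by rewrite /leq; case: (F rho - G rho).
Qed.

Lemma cmpb_eq n F G : cmp n F -> cmp n G ->
  cmpb n (fun rho => F rho == G rho).
Proof.
move=> cF cG; apply: eq_cmp (cmpb_and (cmpb_leq cF cG) (cmpb_leq cG cF)) => rho.
by rewrite eqn_leq.
Qed.

Lemma cmp_if n B F G : cmpb n B -> cmp n F -> cmp n G ->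
  cmp n (fun rho => if B rho then F rho else G rho).
Proof.
move=> cB cF cG; apply: eq_cmp (cmp_add (cmp_mul cB cF)
  (cmp_mul (cmpb_not cB) cG)) => rho.
by case: (B rho); rewrite ?mul1n ?mul0n ?addn0 ?add0n.
Qed.

Lemma cmpb_all n N B : cmp n N ->
  cmpb n.+1 (fun rho => B (rho 0) (fun i => rho i.+1)) ->
  cmpb n (fun rho => all (fun i => B i rho) (iota 0 (N rho))).
Proof.
move=> cN cB; apply: eq_cmp (cmpb_eq (cmp_sum (B := fun i rho => ~~ B i rho) cN
  (cmpb_not cB)) (cmp_const n 0)) => rho; congr nat_of_bool.
rewrite sum_nat_eq0; apply/forallP/allP => [h i|h i].
  by rewrite mem_iota => /andP[_ li]; have := h (Ordinal li); case: (B i rho).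
by rewrite h // mem_iota /=.
Qed.

(** Counting replaces bounded search: quotients, 2-adic valuations and lengths of lists are obtained
    below as the number of indices under a threshold. *)
Lemma sum_ltn m n : m <= n -> \sum_(i < n) (i < m) = m.
Proof.
move=> le_mn; transitivity (\sum_(i < n | i < m) 1).
  by rewrite [RHS]big_mkcond; apply: eq_bigr => i _; case: ltnP.
by rewrite -(big_ord_widen _ (fun=> 1) le_mn) sum1_card card_ord.
Qed.

Lemma cmp_div n F G : cmp n F -> cmp n G -> cmp n (fun rho => F rho %/ G rho).
Proof.
apply: cmp2; apply: eq_cmp (cmp_sum (N := fun rho => rho 0)
  (B := fun i rho => (0 < rho 1) && (i.+1 * rho 1 <= rho 0)) _ _).
- move=> rho; set a := rho 0; case: (posnP (rho 1)) => [-> | b_gt0].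
    by rewrite divn0 big1.
  set b := rho 1 in b_gt0 *; under eq_bigr => i _ do rewrite -leq_divRL //.
  by rewrite sum_ltn ?leq_div.
- exact: cmp_var.
- by apply: cmpb_and; apply: cmpb_leq;
    do ?[exact: cmp_const | exact: cmp_var | apply: cmp_mul | apply: cmp_S].
Qed.

(** Computability is proved by following the syntax of the function; what matches no case is treated
    as a constant. *)
Ltac cmp_basic := cbv beta; first
  [ assumption
  | lazymatch goal with
    | |- cmp ?n (fun rho => nat_of_bool (@?B rho)) => change (cmpb n B)
    | |- cmpb _ (fun rho => ~~ _) => apply: cmpb_not
    | |- cmpb _ (fun rho => _ && _) => apply: cmpb_and
    | |- cmpb _ (fun rho => _ ==> _) => apply: cmpb_imply
    | |- cmpb _ (fun rho => _ <= _) => apply: cmpb_leq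
    | |- cmpb _ (fun rho => _ == _) => apply: cmpb_eq
    | |- cmp _ (fun rho => rho _) => exact: cmp_var
    | |- cmp _ (fun rho => if _ then _ else _) => apply: cmp_if
    | |- cmp _ (fun rho => _ + _) => apply: cmp_add
    | |- cmp _ (fun rho => S _) => apply: cmp_S
    | |- cmp _ (fun rho => _ - _) => apply: cmp_sub
    | |- cmp _ (fun rho => _ * _) => apply: cmp_mul
    | |- cmp _ (fun rho => _ ^ _) => apply: cmp_exp
    | |- cmp _ (fun rho => _.*2) => apply: cmp_double
    | |- cmp _ (fun rho => _ %/ _) => apply: cmp_div
    | |- cmp _ (fun rho => _.-1) => apply: cmp_pred
    | _ => exact: cmp_const
    end ].

Ltac cmp_tac := repeat cmp_basic.

Lemma cmpb_dvd n F G : cmp n F -> cmp n G -> cmpb n (fun rho => F rho %| G rho).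
Proof.
move=> cF cG.
by apply: (@eq_cmp n (fun rho => G rho %/ F rho * F rho == G rho)); 
  [move=> rho; rewrite dvdn_eq | cmp_tac].
Qed.

Lemma cmpb_odd n F : cmp n F -> cmpb n (fun rho => odd (F rho)).
Proof.
move=> cF; apply: (@eq_cmp n (fun rho => ~~ (2 %| F rho))).
  by move=> rho; rewrite dvdn2 negbK.
by apply: cmpb_not; apply: cmpb_dvd; cmp_tac.
Qed.

Lemma cmp_half n F : cmp n F -> cmp n (fun rho => (F rho)./2).
Proof.
move=> cF; apply: (@eq_cmp n (fun rho => F rho %/ 2)); last by cmp_tac.
by move=> rho; rewrite divn2.
Qed.

(** * Decoding lists of numbers *)

Definition chead c := \sum_(i < c) (2 ^ i.+1 %| c).
Definition ctail c := c %/ 2 ^ (chead c).+1.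

(** The code of [v :: s] is [2 ^ v] times an odd number, so its head is its 2-adic valuation,
    counted through the powers of 2 that divide it. *)
Lemma chead_code v s : chead (CodeSeq.code (v :: s)) = v.
Proof.
rewrite /chead /=; set c := (2 ^ v * _).
have vc : v <= c by rewrite (leq_trans (ltnW (ltn_expl v (isT : 1 < 2)))) //
  leq_pmulr.
rewrite -[RHS](sum_ltn vc); apply: eq_bigr => i _; congr nat_of_bool.
case: (ltnP i v) => [iv|vi]; first by rewrite dvdn_mulr // dvdn_exp2l.
apply/negP; rewrite -(subnKC vi) -addnS expnD dvdn_pmul2l ?expn_gt0 //.
by rewrite expnS => /(dvdn_trans (dvdn_mulr _ (dvdnn 2)));
  rewrite dvdn2 /= odd_double.
Qed.

Lemma ctail_code v s : ctail (CodeSeq.code (v :: s)) = CodeSeq.code s.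
Proof.
rewrite /ctail chead_code /= expnSr divnMA mulKn ?expn_gt0 //.
by rewrite divn2 /= uphalf_double.
Qed.

Lemma iter_ctail i s : iter i ctail (CodeSeq.code s) = CodeSeq.code (drop i s).
Proof.
have ctail0 : ctail 0 = 0 by rewrite /ctail div0n.
elim: i s => [|i IHi] s; first by rewrite drop0.
rewrite iterSr; case: s => [|v s]; last by rewrite ctail_code IHi.
by rewrite /= ctail0 (IHi [::]).
Qed.

Lemma cmp_chead n F : cmp n F -> cmp n (fun rho => chead (F rho)).
Proof.
apply: cmp1; rewrite /chead; apply: (cmp_sum (N := fun rho => rho 0)
  (B := fun i rho => 2 ^ i.+1 %| rho 0)); first exact: cmp_var.
by apply: cmpb_dvd; cmp_tac.
Qed.

Lemma cmp_iter_ctail n F G : cmp n F -> cmp n G ->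
  cmp n (fun rho => iter (F rho) ctail (G rho)).
Proof.
apply: (cmp2 (f := fun a b => iter a ctail b)); apply: eq_cmp (cmp_rec (N
  := fun rho => rho 0)
  (F := fun rho => rho 1) (G := fun k z rho => ctail z) _ _ _).
- by move=> rho; elim: (rho 0) => //= k ->.
- exact: cmp_var.
- exact: cmp_var.
- by rewrite /ctail; cmp_tac; apply: cmp_chead; cmp_tac.
Qed.

(** Past the end of the list both sides are 0, since [ctail] and [chead] send 0 to 0. *)
Lemma cmp_nth n F G : cmp n F -> cmp n G ->
  cmp n (fun rho => nth 0 (CodeSeq.decode (F rho)) (G rho)).
Proof.
move=> cF cG; apply: eq_cmp (cmp_chead (cmp_iter_ctail cG cF)) => rho.
rewrite -[F rho]CodeSeq.decodeK iter_ctail CodeSeq.codeK -[G rho in RHS]addn0.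
rewrite -nth_drop; case: drop => [|v s]; last by rewrite chead_code.
by rewrite /chead big_ord0.
Qed.

Lemma cmp_size n F : cmp n F ->
  cmp n (fun rho => size (CodeSeq.decode (F rho))).
Proof.
apply: (cmp1 (f := fun c => size (CodeSeq.decode c)));
  apply: eq_cmp (cmp_sum (N := fun rho => rho 0)
  (B := fun i rho => 0 < iter i ctail (rho 0)) _ _).
- move=> rho; set c := rho 0; set s := CodeSeq.decode c.
  have sc : size s <= c.
    rewrite -[c]CodeSeq.decodeK -/s; elim: s => //= v s IHs.
    by rewrite (leq_trans (n := (CodeSeq.code s).*2.+1)) // ?leq_pmull
      ?expn_gt0 //
         ltnS (leq_trans IHs) // -addnn leq_addl.
  rewrite -[RHS](sum_ltn sc); apply: eq_bigr => i _; congr nat_of_bool.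
  have -> : iter i ctail c = CodeSeq.code (drop i s).
    by rewrite -iter_ctail CodeSeq.decodeK.
  rewrite -[RHS]subn_gt0 -size_drop.
  by case: drop => //= v s'; rewrite muln_gt0 expn_gt0.
- exact: cmp_var.
- by apply: cmpb_leq; first exact: cmp_const; apply: cmp_iter_ctail; cmp_tac.
Qed.

Lemma cmp_code n (T : Type) (js : seq T) (F : T -> (nat -> nat) -> nat) :
  (forall j, cmp n (F j)) ->
  cmp n (fun rho => CodeSeq.code [seq F j rho | j <- js]).
Proof.
by move=> cF; elim: js => /= [|j js IHjs]; cmp_tac.
Qed.

Lemma env_nth n (x : n.-tuple nat) : env_tuple n (nth 0 x) = x.
Proof. by apply: eq_from_tnth => i; rewrite tnth_env -tnth_nth. Qed.

Lemma cmp_computable_fun f : cmp 1 (fun rho => f (rho 0)) -> computable_fun f.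
Proof.
case=> e ef; exists e => x; have := ef (nth 0 x).
by rewrite env_nth /thead (tnth_nth 0).
Qed.

Lemma cmp_computable_rel3 (R : nat -> nat -> nat -> bool) :
  cmpb 3 (fun rho => R (rho 0) (rho 1) (rho 2)) -> computable_rel3 R.
Proof.
case=> e eR; exists e => x; have := eR (nth 0 x).
by rewrite env_nth !(tnth_nth 0).
Qed.

Lemma computable_rel3_cmp (R : nat -> nat -> nat -> bool) :
  computable_rel3 R -> cmpb 3 (fun rho => R (rho 0) (rho 1) (rho 2)).
Proof. by case=> e eR; exists e => rho; have := eR (env_tuple 3 rho);
  rewrite !tnth_env. Qed.

(** * Membership in Pi02 *)

(** Positive and negative part of the integer with code [a]. Arithmetic is done on pairs of
    naturals, and [zcode p q] is the code of the difference [p - q]. *)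
Definition ipos a := if odd a then 0 else a./2.
Definition ineg a := if odd a then a./2.+1 else 0.

Definition zcode p q := if q <= p then (p - q).*2 else (q - p).-1.*2.+1.

Definition int_decode (a : nat) : int := ((ipos a)%:Z - (ineg a)%:Z)%R.

Lemma zcodeE (p q : nat) : int_code (p%:Z - q%:Z)%R = zcode p q.
Proof.
rewrite /zcode; case: leqP => [qp|pq].
  by rewrite (_ : (p%:Z - q%:Z)%R = (p - q)%:Z :> int)%R //; lia.
by rewrite (_ : (p%:Z - q%:Z)%R = Negz (q - p).-1) //; lia.
Qed.

Lemma int_codeK : cancel int_code int_decode.
Proof.
rewrite /int_decode /ipos /ineg => -[n|n] /=; rewrite odd_double /=.
  by rewrite doubleK; lia.
by rewrite uphalf_double; lia.
Qed.

Lemma int_decodeK : cancel int_decode int_code.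
Proof.
move=> a; rewrite zcodeE /zcode /ipos /ineg.
have := odd_double_half a; case: (odd a) => /=; rewrite ?subn0; lia.
Qed.

Definition iadd a b := zcode (ipos a + ipos b) (ineg a + ineg b).
Definition isub a b := zcode (ipos a + ineg b) (ineg a + ipos b).

Lemma iaddE y z : iadd (int_code y) (int_code z) = int_code (y + z)%R.
Proof.
rewrite /iadd /isub -zcodeE; congr int_code; rewrite -[y
  in RHS]int_codeK -[z in RHS]int_codeK.
by rewrite /int_decode; lia.
Qed.

Lemma isubE y z : isub (int_code y) (int_code z) = int_code (y - z)%R.
Proof.
rewrite /iadd /isub -zcodeE; congr int_code; rewrite -[y
  in RHS]int_codeK -[z in RHS]int_codeK.
by rewrite /int_decode; lia.
Qed.

Section VectorCodes.
Variable d : nat.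

Definition vmap2 (op : nat -> nat -> nat) p q :=
  CodeSeq.code [seq op (nth 0 (CodeSeq.decode p) j) (nth 0 (CodeSeq.decode q) j)
                 | j <- iota 0 d].

Lemma nth_vector_code (v : 'rV[int]_d) (j : 'I_d) :
  nth 0 (CodeSeq.decode (vector_code v)) j = int_code (v ord0 j).
Proof.
by rewrite CodeSeq.codeK (nth_map j) ?size_enum_ord // nth_ord_enum.
Qed.

Lemma size_vector_code (v : 'rV[int]_d) :
  size (CodeSeq.decode (vector_code v)) = d.
Proof. by rewrite CodeSeq.codeK size_map size_enum_ord. Qed.

Lemma vmap2E op (f : int -> int -> int) (u v w : 'rV[int]_d) :
  (forall y z, op (int_code y) (int_code z) = int_code (f y z)) ->
  (forall i, w ord0 i = f (u ord0 i) (v ord0 i)) ->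
  vmap2 op (vector_code u) (vector_code v) = vector_code w.
Proof.
move=> opE wE; rewrite /vmap2 -val_enum_ord -map_comp; congr CodeSeq.code.
by apply: eq_map => j /=; rewrite !nth_vector_code opE wE.
Qed.

Lemma vaddE (u v : 'rV[int]_d) :
  vmap2 iadd (vector_code u) (vector_code v) = vector_code (u + v)%R.
Proof. by apply: vmap2E iaddE _ => i; rewrite mxE. Qed.

Lemma vsubE (u v : 'rV[int]_d) :
  vmap2 isub (vector_code u) (vector_code v) = vector_code (u - v)%R.
Proof. by apply: vmap2E isubE _ => i; rewrite !mxE. Qed.

Definition vdecode p : 'rV[int]_d :=
  \row_i int_decode (nth 0 (CodeSeq.decode p) i).

Lemma vdecodeK p : size (CodeSeq.decode p) = d -> vector_code (vdecode p) = p.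
Proof.
move=> sp; apply: (can_inj CodeSeq.decodeK); apply: (@eq_from_nth _ 0).
  by rewrite size_vector_code.
rewrite size_vector_code => i lid.
by rewrite (nth_vector_code _ (Ordinal lid)) mxE int_decodeK.
Qed.

Lemma vector_codeK : cancel (@vector_code d) vdecode.
Proof. by move=> v; apply: vector_code_inj;
  rewrite vdecodeK ?size_vector_code. Qed.

End VectorCodes.

(** * Base-k digits and rule tables *)

Lemma digits_sum k j n : \sum_(i < n) (j %/ k ^ i %% k) * k ^ i = j %% k ^ n.
Proof.
elim: n => [|n IHn]; first by rewrite big_ord0 expn0 modn1.
rewrite big_ord_recr /= IHn expnSr; case: (posnP k) => [->|k_gt0].
  by case: n {IHn} => [|n]; rewrite ?expn0 ?exp0n // ?mul1n ?muln1 ?muln0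
    ?modn1 ?divn1 ?modn0 ?addn0.
rewrite [in RHS](divn_eq j (k ^ n)) [in RHS](divn_eq (j %/ k ^ n) k).
rewrite mulnDl -mulnA -[k * _]mulnC -addnA modnMDl [RHS]modn_small 1?addnC //.
apply: (@leq_trans ((j %/ k ^ n %% k).+1 * k ^ n)).
  by rewrite mulSn ltn_add2r ltn_mod expn_gt0 k_gt0.
by rewrite mulnC leq_mul2l ltn_mod k_gt0 orbT.
Qed.

Lemma sum_digits_lt k n (f : nat -> nat) : (forall i, i < n -> f i < k) ->
  \sum_(i < n) f i * k ^ i < k ^ n.
Proof.
elim: n => [|n IHn] fk; first by rewrite big_ord0.
rewrite big_ord_recr /= expnSr.
have lt := IHn (fun i li => fk i (ltnW li)).
apply: (@leq_trans ((f n).+1 * k ^ n)); first by rewrite mulSn ltn_add2r.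
by rewrite mulnC leq_mul2l fk ?orbT.
Qed.

Lemma digit_sum k n (f : nat -> nat) j : (forall i, i < n -> f i < k) ->
  j < n -> (\sum_(i < n) f i * k ^ i) %/ k ^ j %% k = f j.
Proof.
elim: n => // n IHn fk; rewrite ltnS leq_eqVlt big_ord_recr /=.
have k_gt0 : 0 < k by apply: leq_ltn_trans (fk n _).
have fk' i : i < n -> f i < k by move=> /ltnW; apply: fk.
case/predU1P => [->|jn].
  rewrite addnC divnMDl ?expn_gt0 ?k_gt0 //.
  by rewrite (divn_small (sum_digits_lt fk')) addn0 modn_small ?fk.
have -> : f n * k ^ n = f n * k ^ (n - j.+1) * k * k ^ j.
  by rewrite -!mulnA -expnS -expnD subnK.
by rewrite addnC divnMDl ?expn_gt0 ?k_gt0 // modnMDl IHn.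
Qed.

Section Rules.
Variables (d : nat) (A : cellular_automaton d).

Definition pattern_get (p : {ffun seq_sub (ca_nbhd A) -> ca_state A}) i : nat :=
  if insub (nth 0%R (ca_nbhd A) i) is Some n then p n else 0.

Definition pattern_index p : nat :=
  \sum_(i < size (ca_nbhd A)) pattern_get p i * (ca_top A).+1 ^ i.

Lemma pattern_getE p (n : seq_sub (ca_nbhd A)) :
  pattern_get p (index (val n) (ca_nbhd A)) = p n.
Proof. by rewrite /pattern_get nth_index ?(valP n) // valK. Qed.

Lemma pattern_get_lt p i : pattern_get p i < (ca_top A).+1.
Proof. by rewrite /pattern_get; case: insub. Qed.

Lemma pattern_indexK : cancel pattern_index (pattern_of_nat A).
Proof.
move=> p; apply/ffunP => n; apply: val_inj; rewrite ffunE /= inordK ?ltn_mod //.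
rewrite digit_sum ?pattern_getE ?index_mem ?(valP n) // => i _.
exact: pattern_get_lt.
Qed.

Lemma pattern_of_natK j : j < (ca_top A).+1 ^ size (ca_nbhd A) ->
  pattern_index (pattern_of_nat A j) = j.
Proof.
move=> lj; rewrite -[RHS](modn_small lj) -digits_sum.
apply: eq_bigr => i _; congr (_ * _); rewrite /pattern_get insubT.
  exact: mem_nth.
by move=> iN; rewrite ffunE /= inordK ?ltn_mod // index_uniq ?ca_nbhd_uniq.
Qed.

Lemma pattern_index_lt p :
  pattern_index p < (ca_top A).+1 ^ size (ca_nbhd A).
Proof. by apply: sum_digits_lt => i _; apply: pattern_get_lt. Qed.

Lemma nth_rule_table p : nth 0 (rule_table A) (pattern_index p) = ca_rule A p.
Proof.
have lt := pattern_index_lt p.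
by rewrite (nth_map 0) ?size_iota // nth_iota // add0n pattern_indexK.
Qed.

End Rules.

Section Validity.
Variable d : nat.

Definition code_item m i := nth 0 (CodeSeq.decode m) i.
Definition code_items m i := CodeSeq.decode (code_item m i).

Definition valid_code m := [&& size (CodeSeq.decode m) == 3, 0 < code_item m 0,
  all (fun i => size (code_items (code_item m 1) i) == d)
      (iota 0 (size (code_items m 1))),
  all (fun i => all (fun j => code_item (code_item m 1) i
                               != code_item (code_item m 1) j) (iota 0 i))
      (iota 0 (size (code_items m 1))),
  size (code_items m 2) == code_item m 0 ^ size (code_items m 1),
  all (fun i => code_item (code_item m 2) i < code_item m 0)
      (iota 0 (size (code_items m 2)))
  & code_item (code_item m 2) 0 == 0].

(** The next state at the vector with code [p], looked up in the rule table: the sum is the index of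
    the pattern that [D] shows around [p]. *)
Definition table_entry m D p := code_item (code_item m 2)
  (\sum_(0 <= i < size (code_items m 1))
     code_item D (vmap2 d iadd p (code_item (code_item m 1) i))
       * code_item m 0 ^ i).

Variable A : cellular_automaton d.

Lemma code_item_states : code_item (ca_code A) 0 = (ca_top A).+1.
Proof. by rewrite /code_item CodeSeq.codeK. Qed.

Lemma code_items_nbhd :
  code_items (ca_code A) 1 = [seq vector_code v | v <- ca_nbhd A].
Proof. by rewrite /code_items /code_item !CodeSeq.codeK. Qed.

Lemma code_items_rule : code_items (ca_code A) 2 = rule_table A.
Proof. by rewrite /code_items /code_item !CodeSeq.codeK. Qed.

Lemma code_item_nbhd i : code_item (code_item (ca_code A) 1) i =
  nth 0 [seq vector_code v | v <- ca_nbhd A] i.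
Proof. by rewrite -code_items_nbhd. Qed.

Lemma code_item_rule i : code_item (code_item (ca_code A) 2) i =
  nth 0 (rule_table A) i.
Proof. by rewrite -code_items_rule. Qed.

Lemma ca_code_valid : valid_code (ca_code A).
Proof.
rewrite /valid_code code_item_states code_items_nbhd code_items_rule.
rewrite {1}CodeSeq.codeK size_map eqxx /=; apply/and5P; split.
- apply/allP => i; rewrite mem_iota => /andP[_ li].
  by rewrite /code_items code_item_nbhd (nth_map 0%R) // size_vector_code.
- apply/allP => i; rewrite mem_iota => /andP[_ li].
  apply/allP => j; rewrite mem_iota => /andP[_ lj].
  rewrite add0n in li lj; have lj' := ltn_trans lj li.
  rewrite !code_item_nbhd !(nth_map 0%R) //.
  apply: contraTneq lj => /vector_code_inj/eqP.
  by rewrite nth_uniq ?ca_nbhd_uniq // => /eqP ->; rewrite ltnn.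
- by rewrite size_map size_iota.
- apply/allP => i; rewrite mem_iota => /andP[_ li].
  by rewrite code_item_rule (nth_map 0) // -(size_map (fun j => (ca_rule A
    (pattern_of_nat A j) : nat))).
- rewrite code_item_rule.
  have q0 : pattern_index [ffun=> ord0 : ca_state A] = 0.
    apply: big1 => i _; rewrite /pattern_get; case: insub => // n.
    by rewrite ffunE.
  by rewrite -[X in nth 0 _ X]q0 nth_rule_table ca_quiescent.
Qed.

Lemma ca_global_code (c : configuration A) D :
  (forall v, c v = code_item D (vector_code v) :> nat) ->
  forall v, ca_global c v = table_entry (ca_code A) D (vector_code v) :> nat.
Proof.
move=> cD v; rewrite /table_entry code_item_states code_items_nbhd
  code_item_rule.
rewrite size_map big_mkord /ca_global -nth_rule_table; congr nth.
apply: eq_bigr => i _; congr (_ * _); rewrite code_item_nbhd (nth_map 0%R) //.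
by rewrite vaddE -cD /pattern_get insubT ?mem_nth // => iN; rewrite ffunE.
Qed.

End Validity.

(** The arithmetical conditions that [nilpotency_rel] can test suffice for rebuilding an automaton
    from the decoded neighborhood and table. *)
Lemma valid_code_surj d m : valid_code d m ->
  exists A : cellular_automaton d, ca_code A = m.
Proof.
case/and5P => /eqP sm k_gt0 /allP sN /allP uN /and3P[/eqP sT /allP kT /eqP T0].
pose k := (code_item m 0).-1; have kE : code_item m 0 = k.+1 by rewrite prednK.
pose N := [seq vdecode d p | p <- code_items m 1].
have NE : [seq vector_code v | v <- N] = code_items m 1.
  rewrite -map_comp map_id_in // => p /(nthP 0)[i li <-] /=.
  by rewrite vdecodeK //; apply/eqP/sN; rewrite mem_iota.
have sNE : size N = size (code_items m 1) by rewrite size_map.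
have Nu : uniq N.
  rewrite -(map_inj_uniq (@vector_code_inj d)) NE.
  apply/(uniqP 0) => i j; rewrite !inE => li lj e.
  wlog ij : i j li lj e / j < i.
    by case: (ltngtP i j) => // ij H; [symmetry|]; apply: H.
  have /allP/(_ j): all (fun j => code_item (code_item m 1) i != code_item
    (code_item m 1) j) (iota 0 i) by apply: uN; rewrite mem_iota.
  rewrite mem_iota => /(_ ij).
  by rewrite /code_item -/(code_items m 1) e eqxx.
pose idx (p : {ffun seq_sub N -> 'I_k.+1}) := \sum_(i < size N)
  (if insub (nth 0%R N i) is Some n then p n : nat else 0) * k.+1 ^ i.
pose f : {ffun {ffun seq_sub N -> 'I_k.+1} -> 'I_k.+1} :=
  [ffun p => inord (code_item (code_item m 2) (idx p))].
have f0 : f [ffun=> ord0] = ord0.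
  rewrite ffunE (_ : idx _ = 0) ?T0; first by apply: val_inj; rewrite /= inordK.
  by apply: big1 => i _; case: insub => // n; rewrite ffunE.
exists (CellularAutomaton Nu f0); apply: (can_inj CodeSeq.decodeK).
rewrite CodeSeq.codeK /=; apply: (@eq_from_nth _ 0) => [|i];
  first by rewrite sm.
have TE : rule_table (CellularAutomaton Nu f0) = code_items m 2.
  have st : size (rule_table (CellularAutomaton Nu f0)) = size (code_items m 2).
    by rewrite size_map size_iota sT kE sNE.
  apply: (@eq_from_nth _ 0) => // j; rewrite st => lj.
  have lj' : j < k.+1 ^ size N by rewrite sNE -kE -sT.
  rewrite (nth_map 0) ?size_iota // nth_iota // add0n /= ffunE.
  rewrite [idx _](@pattern_of_natK d (CellularAutomaton Nu f0)) // inordK //.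
  by rewrite -kE; apply: kT; rewrite mem_iota.
by case: i => [|[|[|//]]] _ /=; rewrite ?NE ?TE ?CodeSeq.decodeK.
Qed.

(** * Certificates of death *)

Section Certificates.
Variable d : nat.

(* A configuration is presented as the list of its states indexed by the      *)
(* codes of the vectors, extended by zeros; indices that are not codes of     *)
(* vectors are ignored. The second half of [step_code] ensures that the list  *)
(* [E] is long enough to contain the support of the new configuration.        *)
Definition config_code m y :=
  all (fun p => code_item y p < code_item m 0) (iota 0 (size (CodeSeq.decode
    y))).

Definition step_code m D E :=
  all (fun p => (size (CodeSeq.decode p) == d) ==>
                (code_item E p == table_entry d m D p))
      (iota 0 (size (CodeSeq.decode E))) &&
  all (fun w => (size (CodeSeq.decode w) == d) ==>
         all (fun i => vmap2 d isub w (code_item (code_item m 1) i)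
                         < size (CodeSeq.decode E))
             (iota 0 (size (code_items m 1))))
      (iota 0 (size (CodeSeq.decode D))).

Definition death_code m y z :=
  [&& 0 < size (CodeSeq.decode z), code_item z 0 == y,
      all (fun t => step_code m (code_item z t) (code_item z t.+1))
          (iota 0 (size (CodeSeq.decode z)).-1)
    & all (fun p => (size (CodeSeq.decode p) == d) ==>
             (code_item (code_item z (size (CodeSeq.decode z)).-1) p == 0))
          (iota 0 (size (code_items z (size (CodeSeq.decode z)).-1)))].

Definition nilpotency_rel m y z :=
  valid_code d m && (config_code m y ==> death_code m y z).

Lemma cmp_vmap2 op n F G :
  (forall k P Q, cmp k P -> cmp k Q -> cmp k (fun rho => op (P rho) (Q rho))) ->
  cmp n F -> cmp n G -> cmp n (fun rho => vmap2 d op (F rho) (G rho)).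
Proof.
move=> cop cF cG; apply: (@cmp_code _ _ _ (fun j rho =>
  op (nth 0 (CodeSeq.decode (F rho)) j) (nth 0 (CodeSeq.decode (G rho)) j))) =>
    j.
by apply: cop; apply: cmp_nth => //; apply: cmp_const.
Qed.

Ltac cmp_big := first [ cmp_basic | lazymatch goal with
  | |- cmpb _ (fun rho => odd _) => apply: cmpb_odd
  | |- cmp _ (fun rho => _./2) => apply: cmp_half
  | |- cmp _ (fun rho => nth 0 (CodeSeq.decode _) _) => apply: cmp_nth
  | |- cmp _ (fun rho => size (CodeSeq.decode _)) => apply: cmp_size
  | |- cmpb _ (fun rho => all _ (iota 0 _)) => apply: cmpb_all
  | |- cmp _ (fun rho => bigop _ _ _) => apply: cmp_sum_nat
  end ].

Lemma cmp_iadd k P Q : cmp k P -> cmp k Q ->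
  cmp k (fun rho => iadd (P rho) (Q rho)).
Proof. by move=> cP cQ; rewrite /iadd /zcode /ipos /ineg; repeat cmp_big. Qed.

Lemma cmp_isub k P Q : cmp k P -> cmp k Q ->
  cmp k (fun rho => isub (P rho) (Q rho)).
Proof. by move=> cP cQ; rewrite /isub /zcode /ipos /ineg; repeat cmp_big. Qed.

Lemma cmpb_nilpotency_rel :
  cmpb 3 (fun rho => nilpotency_rel (rho 0) (rho 1) (rho 2)).
Proof.
rewrite /nilpotency_rel /valid_code /config_code /death_code /step_code.
rewrite /table_entry /code_items /code_item.
repeat first [ cmp_big | lazymatch goal with
  | |- cmp _ (fun rho => vmap2 _ iadd _ _) => apply: (cmp_vmap2 cmp_iadd)
  | |- cmp _ (fun rho => vmap2 _ isub _ _) => apply: (cmp_vmap2 cmp_isub)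
  end ].
Qed.

End Certificates.

(** * Soundness and completeness of certificates *)

Section Membership.
Local Open Scope classical_set_scope.
Variable d : nat.

(** A nonzero new state needs a neighbor in the old support. Supports are bounded by codes of
    vectors instead of norms, because configurations are lists indexed by codes. *)
Lemma ca_global_outside (A : cellular_automaton d) (c : configuration A) P Q :
  (forall (v : 'rV[int]_d) n, vector_code v < P -> n \in ca_nbhd A ->
     vector_code (v - n)%R < Q) ->
  (forall v, P <= vector_code v -> c v = ord0) ->
  forall v, Q <= vector_code v -> ca_global c v = ord0.
Proof.
move=> PQ cP v Qv; rewrite /ca_global -[RHS](ca_quiescent A);
  congr (ca_rule A _).
apply/ffunP => n; rewrite !ffunE; apply: cP; rewrite leqNgt; apply/negP => lt.
by have := PQ _ _ lt (valP n); rewrite GRing.addrK ltnNge Qv.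
Qed.

Section Completeness.
Variables (A : cellular_automaton d) (y : nat).
Hypothesis y_config : config_code (ca_code A) y.

Let c : configuration A := fun v => inord (code_item y (vector_code v)).

Let cE v : c v = code_item y (vector_code v) :> nat.
Proof.
rewrite inordK // ltnS -ltnS; have := allP y_config (vector_code v).
rewrite mem_iota /= code_item_states; case: ltnP => [_ -> //|le _].
by rewrite /code_item nth_default.
Qed.

(** One more than the largest code reached in a step from a code below [P]; a [w] that is not a code
    can only enlarge it. *)
Let bound P := (\max_(w < P) \max_(n <- ca_nbhd A)
  vector_code (vdecode d w - n)%R).+1.

Let radius t := iter t bound (size (CodeSeq.decode y)).

Let boundP P (v : 'rV[int]_d) n : vector_code v < P -> n \in ca_nbhd A ->
  vector_code (v - n)%R < bound P.
Proof.
move=> lt nN; rewrite ltnS -[v in (v - n)%R]vector_codeK.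
apply: (@leq_trans (\max_(n <- ca_nbhd A)
   vector_code (vdecode d (Ordinal lt) - n)%R)); last exact: leq_bigmax.
by rewrite (big_rem n nN) leq_maxl.
Qed.

Let radiusP t v : radius t <= vector_code v ->
  iter t (@ca_global d A) c v = ord0.
Proof.
elim: t v => [|t IHt] v.
  by move=> le; apply: val_inj; rewrite /= cE /code_item nth_default.
by apply: (ca_global_outside (@boundP _)).
Qed.

(** A certificate must start with [y] itself, not just with a list presenting the same
    configuration; hence the special case. *)
Let layer t := CodeSeq.code (if t is 0 then CodeSeq.decode y else
  mkseq (fun p => if size (CodeSeq.decode p) == d then
    nat_of_ord (iter t (@ca_global d A) c (vdecode d p)) else 0) (radius t)).

Let size_layer t : size (CodeSeq.decode (layer t)) = radius t.
Proof. by rewrite CodeSeq.codeK; case: t => // t; rewrite size_mkseq. Qed.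

Let layerE t v :
  iter t (@ca_global d A) c v = code_item (layer t) (vector_code v) :> nat.
Proof.
rewrite /code_item CodeSeq.codeK; case: t => [|t]; first exact: cE.
case: (ltnP (vector_code v) (radius t.+1)) => [lt|le].
  by rewrite nth_mkseq // size_vector_code eqxx vector_codeK.
by rewrite nth_default ?size_mkseq // radiusP.
Qed.

Lemma death_code_complete n : (forall v, iter n (@ca_global d A) c v = ord0) ->
  exists z, death_code d (ca_code A) y z.
Proof.
move=> c0; exists (CodeSeq.code (mkseq layer n.+1)).
have item t : t <= n -> code_item (CodeSeq.code (mkseq layer n.+1)) t = layer t.
  by move=> tn; rewrite /code_item CodeSeq.codeK nth_mkseq.
rewrite /death_code /code_items CodeSeq.codeK size_mkseq /=; apply/and3P; split.
- by rewrite item // /layer CodeSeq.decodeK.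
- apply/allP => t; rewrite mem_iota => /andP[_ tn].
  rewrite !item //; last exact: ltnW.
  apply/andP; split; apply/allP => p; rewrite mem_iota /= size_layer => lp;
    apply/implyP => /eqP dp; rewrite -(vdecodeK dp).
    by rewrite -(ca_global_code (@layerE t)) -layerE.
  rewrite size_layer code_items_nbhd size_map; apply/allP => i.
  rewrite mem_iota => /andP[_ li]; rewrite code_item_nbhd (nth_map 0%R) //
    vsubE.
  by apply: boundP; rewrite ?vdecodeK ?mem_nth.
- rewrite item //; apply/allP => p _; apply/implyP => /eqP dp.
  by rewrite -(vdecodeK dp) -layerE c0.
Qed.

End Completeness.

Lemma death_code_sound (A : cellular_automaton d) (c : configuration A) y z :
  (forall v, c v = code_item y (vector_code v) :> nat) ->
  death_code d (ca_code A) y z ->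
  exists n, forall v, iter n (@ca_global d A) c v = ord0.
Proof.
move=> cy /and4P[z_gt0 /eqP zy /allP z_step /allP z_last].
set n := (size (CodeSeq.decode z)).-1 in z_step z_last; exists n.
suff zE t : t <= n -> forall v,
    iter t (@ca_global d A) c v = code_item (code_item z t) (vector_code v) :>
      nat.
  move=> v; apply: val_inj; rewrite /= zE //.
  case: (ltnP (vector_code v) (size (code_items z n))) => [lt|le].
    apply/eqP; have := z_last (vector_code v).
    by rewrite mem_iota size_vector_code eqxx => /(_ lt).
  by rewrite /code_item nth_default.
elim: t => [_ v|t IHt tn v]; first by rewrite zy -cy.
have {}IHt := IHt (ltnW tn).
have /andP[/allP step_eq /allP step_size]
  := z_step t ltac:(by rewrite mem_iota).
set E := code_item z t.+1 in step_eq step_size *.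
case: (ltnP (vector_code v) (size (CodeSeq.decode E))) => [lt|le].
  have := step_eq (vector_code v); rewrite mem_iota size_vector_code eqxx.
  by move=> /(_ lt)/eqP ->; exact: ca_global_code.
rewrite [RHS]nth_default //=.
suff -> : ca_global (iter t (@ca_global d A) c) v = ord0 by [].
apply: (ca_global_outside (P := size (CodeSeq.decode (code_item z t)))
  (Q := size (CodeSeq.decode E))) le => [w m ltw mN|w lew].
  have := step_size (vector_code w); rewrite mem_iota size_vector_code eqxx.
  move=> /(_ ltw)/allP/(_ (index m (ca_nbhd A))).
  rewrite mem_iota code_items_nbhd size_map index_mem => /(_ mN).
  by rewrite code_item_nbhd (nth_map 0%R) ?index_mem // nth_index // vsubE.
by apply: val_inj; rewrite /= IHt /code_item nth_default.
Qed.

Lemma finite_configuration_code (A : cellular_automaton d) (c : configuration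
  A) :
  finite_configuration c -> exists2 y, config_code (ca_code A) y
    & forall v, c v = code_item y (vector_code v) :> nat.
Proof.
case/finite_seqP => s sE.
pose P := (\max_(v <- s) vector_code v).+1.
exists (CodeSeq.code (mkseq (fun p => (c (vdecode d p) : nat)) P)).
  apply/allP => p; rewrite mem_iota CodeSeq.codeK size_mkseq => /andP[_ lp].
  by rewrite /code_item CodeSeq.codeK nth_mkseq // -/(code_item _ 0)
    code_item_states.
move=> v; rewrite /code_item CodeSeq.codeK.
case: (ltnP (vector_code v) P) => [lt|le];
  first by rewrite nth_mkseq // vector_codeK.
rewrite nth_default ?size_mkseq //; have [-> //|/eqP cv] := eqVneq (c v) ord0.
have vs : v \in s by have : [set` s] v by rewrite -sE.
by move: le; rewrite leqNgt ltnS (big_rem v vs) /= leq_maxl.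
Qed.

Lemma Pi02_nilpotent_ca_codes : Pi02 (nilpotent_ca_codes d).
Proof.
exists (nilpotency_rel d); first by apply: cmp_computable_rel3;
  apply: cmpb_nilpotency_rel.
move=> m; split=> [[A <- A_nil] y|mR].
  rewrite /nilpotency_rel ca_code_valid /=.
  case: (boolP (config_code (ca_code A) y)) => [cy|_]; last by exists 0.
  have [|n c0] := A_nil (fun v => inord (code_item y (vector_code v)));
    last first.
    exact: death_code_complete c0.
  apply: (@sub_finite_set _ _ [set vdecode d p | p
    in `I_(size (CodeSeq.decode y))]).
    move=> v /= cv; exists (vector_code v); last exact: vector_codeK.
    rewrite /= ltnNge; apply/negP => le; apply: cv.
    by apply: val_inj; rewrite /= /code_item nth_default ?inordK.
  exact/finite_image/finite_II.
(* Any instance of the relation shows that [m] is a code; 0 is an arbitrary choice. *)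
have [z /andP[/valid_code_surj[A AE] _]] := mR 0.
exists A => // c /finite_configuration_code[y cy cyE].
have [{}z] := mR y; rewrite /nilpotency_rel -AE cy /= => /andP[_].
exact: death_code_sound.
Qed.

End Membership.

(** * A register machine for unbounded search *)

Inductive op := Incr of nat | Decr of nat | Copy of nat & nat | Zero of nat.

Definition store := nat -> nat.

Definition upd (s : store) r v : store := fun r' => if r' == r then v else s r'.

Lemma updE s r v r' : upd s r v r' = if r' == r then v else s r'.
Proof. by []. Qed.

Definition op_store o (s : store) : store :=
  match o with
  | Incr r => upd s r (s r).+1
  | Decr r => upd s r (s r).-1
  | Copy r r' => upd s r (s r')
  | Zero r => upd s r 0
  end.

Definition op_flag o (s : store) : bool :=
  match o with
  | Incr _ => true
  | Decr r => 0 < s r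
  | Copy _ r' => 0 < s r'
  | Zero _ => false
  end.

Definition op_below K o :=
  match o with
  | Incr r | Decr r | Zero r => r < K
  | Copy r r' => (r < K) && (r' < K)
  end.

(* [Loop r c] is [while r <> 0 do c].                                        *)
Inductive cmd := Do of op | Seq of cmd & cmd | Loop of nat & cmd | Skip.

Inductive exec : cmd -> store -> store -> Prop :=
| exec_do o s : exec (Do o) s (op_store o s)
| exec_seq c c' s s' s'' : exec c s s' -> exec c' s' s'' ->
  exec (Seq c c') s s''
| exec_done r c s : s r = 0 -> exec (Loop r c) s s
| exec_loop r c s s' s'' : s r != 0 -> exec c s s' -> exec (Loop r c) s' s'' ->
    exec (Loop r c) s s''
| exec_skip s : exec Skip s s.

(* An instruction is an operation with two continuation addresses, selected  *)
(* by the flag of the operation; running off the end of a program halts it.  *)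
Definition instr := (op * nat * nat)%type.

(** Also executed by a head that is found at the halting location away from the origin, where
    halting is not recognized. *)
Definition no_instr : instr := (Zero 0, 0, 0).

Definition run1 (P : seq instr) (x : nat * store) : nat * store :=
  if x.1 < size P then
    let: (o, q1, q2) := nth no_instr P x.1 in
    (if op_flag o x.2 then q1 else q2, op_store o x.2)
  else x.

(* Testing [r] is copying it onto itself.                                    *)
Fixpoint compile (c : cmd) (a : nat) : seq instr :=
  match c with
  | Do o => [:: (o, a.+1, a.+1)]
  | Seq c c' => let p := compile c a in p ++ compile c' (a + size p)
  | Loop r c => let p := compile c a.+1 in let b := a.+1 + size p in
      (Copy r r, a.+1, b.+1) :: rcons p (Copy r r, a.+1, b.+1)
  | Skip => [::]
  end.

Definition loads (P : seq instr) a p :=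
  exists pre post, P = pre ++ p ++ post /\ size pre = a.

Lemma loads_catl P a p p' : loads P a (p ++ p') -> loads P a p.
Proof. by case=> pre [post [-> <-]]; exists pre, (p' ++ post);
  rewrite -catA. Qed.

Lemma loads_catr P a p p' : loads P a (p ++ p') -> loads P (a + size p) p'.
Proof.
case=> pre [post [-> <-]]; exists (pre ++ p), post.
by rewrite -!catA size_cat.
Qed.

Lemma run1_loads P a o q1 q2 p s : loads P a ((o, q1, q2) :: p) ->
  run1 P (a, s) = (if op_flag o s then q1 else q2, op_store o s).
Proof.
case=> pre [post [-> <-]]; rewrite /run1 /= size_cat /= -ltn_subLR // subnn.
by rewrite nth_cat ltnn subnn.
Qed.

Lemma upd_same s r : upd s r (s r) = s.
Proof. by apply: funext => r'; rewrite updE; case: eqP => [->|]. Qed.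

(** The tests before and after the body have the same continuations, so reaching the closing test
    amounts to entering the loop anew. *)
Lemma loads_loop P a r c : loads P a (compile (Loop r c) a) ->
  [/\ loads P a.+1 (compile c a.+1),
      forall s, run1 P (a, s) =
        (if 0 < s r then a.+1 else a + size (compile (Loop r c) a), s)
    & forall s, run1 P (a.+1 + size (compile c a.+1), s) =
        (if 0 < s r then a.+1 else a + size (compile (Loop r c) a), s)].
Proof.
move=> lP; have le : (a.+1 + size (compile c a.+1)).+1 =
    a + size (compile (Loop r c) a) by rewrite /= size_rcons !addnS addSn.
have lP' : loads P a.+1 (rcons (compile c a.+1)
    (Copy r r, a.+1, (a.+1 + size (compile c a.+1)).+1)).
  by have := @loads_catr P a [:: _] _ lP; rewrite /= addn1.
rewrite -cats1 in lP'; split=> [|s|s]; first exact: loads_catl lP'.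
- by rewrite (run1_loads _ lP) /= upd_same -le.
- by rewrite (run1_loads _ (loads_catr lP')) /= upd_same -le.
Qed.

Lemma compile_exec c s s' : exec c s s' -> forall P a,
  loads P a (compile c a) ->
  exists k, iter k (run1 P) (a, s) = (a + size (compile c a), s').
Proof.
elim=> {c s s'} [o s|c c' s s' s'' _ IHc _ IHc'|r c s sr|r c s s' s'' sr _ IHc
  _ IHl|s] P a lP.
- by exists 1; rewrite /= (run1_loads _ lP) addn1; case: op_flag.
- have [k kE] := IHc _ _ (loads_catl lP).
  have [k' k'E] := IHc' _ _ (loads_catr lP).
  by exists (k' + k); rewrite iterD kE k'E /= size_cat addnA.
- by exists 1; rewrite /=; have [_ -> _] := loads_loop lP; rewrite sr.
- have [lc run_a run_b] := loads_loop lP.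
  have [k kE] := IHc _ _ lc; have [[|k'] k'E] := IHl _ _ lP.
    (* The remaining loop takes at least one step, as it ends at another address; the closing test
       replaces that first step. *)
    by move: k'E => /= [/eqP]; rewrite -[X in X == _]addn0 eqn_add2l.
  exists (k' + k.+2); rewrite iterD iterS iterSr run_a lt0n sr kE.
  by rewrite run_b -run_a -iterSr.
- by exists 0; rewrite addn0.
Qed.

Lemma iter_run1_halted P k x : size P <= x.1 -> iter k (run1 P) x = x.
Proof. by move=> le; elim: k => //= k ->; rewrite /run1 ltnNge le. Qed.

(** * Compiling recursive functions into register programs *)

Definition icons n r (ins : 'I_n -> nat) (i : 'I_n.+1) : nat :=
  if unlift ord0 i is Some j then ins j else r.

(* Registers [fr] and above are free for the use of the program.             *)
Fixpoint translate n (e : recfun n) : ('I_n -> nat) -> nat -> nat -> cmd :=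
  match e in recfun n return ('I_n -> nat) -> nat -> nat -> cmd with
  | rec_zero _ => fun _ out _ => Do (Zero out)
  | rec_succ => fun ins out _ =>
      Seq (Do (Copy out (ins ord0))) (Do (Incr out))
  | rec_proj _ i => fun ins out _ => Do (Copy out (ins i))
  | rec_comp m _ f g => fun ins out fr =>
      Seq (foldr (fun i c => Seq (translate (g i) ins (fr + i) (fr + m)) c) Skip
             (enum 'I_m))
        (translate f (fun i => fr + i) out (fr + m))
  | rec_prim _ f g => fun ins out fr =>
      let tl := fun i => ins (lift ord0 i) in
      Seq (Seq (translate f tl out fr)
               (Seq (Do (Copy fr (ins ord0))) (Do (Zero fr.+1))))
        (Loop fr (Seq (translate g (icons fr.+1 (icons out tl)) fr.+2 fr.+3)
                    (Seq (Do (Copy out fr.+2))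
                      (Seq (Do (Incr fr.+1)) (Do (Decr fr))))))
  | rec_mu _ f => fun ins out fr =>
      let body := translate f (icons out ins) fr fr.+1 in
      Seq (Seq (Do (Zero out)) body) (Loop fr (Seq (Do (Incr out)) body))
  end.

Definition agree (fr out : nat) (s s' : store) :=
  forall r, r < fr -> r != out -> s' r = s r.

Lemma iconsP n r (ins : 'I_n -> nat) (Q : nat -> Prop) :
  Q r -> (forall i, Q (ins i)) -> forall i, Q (icons r ins i).
Proof. by move=> Qr Qi i; rewrite /icons; case: unliftP. Qed.

Lemma icons_store n r (ins : 'I_n -> nat) (s : store) v (x : n.-tuple nat) :
  s r = v -> (forall i, s (ins i) = tnth x i) ->
  forall i, s (icons r ins i) = tnth (cons_tuple v x) i.
Proof.
move=> sr si i; rewrite /icons; case: unliftP => [j|] -> //.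
by rewrite tnthS.
Qed.

(** Scratch registers may hold garbage at the start; [agree] is the frame property that lets
    subprograms be chained. In primitive recursion [fr] counts down, [fr.+1] holds the index,
    [fr.+2] the new value and [out] the current one. In minimization [out] is the candidate and [fr]
    the value of [f] at it. *)
Lemma translate_exec n (e : recfun n) : forall x y, computes e x y ->
  forall ins out fr s, (forall i, ins i < fr) -> out < fr ->
  (forall i, ins i != out) -> (forall i, s (ins i) = tnth x i) ->
  exists s', [/\ exec (translate e ins out fr) s s', s' out = y & agree fr out
    s s'].
Proof.
elim: e => {n} [n||n i|m n f IHf g IHg|n f IHf g IHg|n f IHf] x y.
- move=> /= -> ins out fr s _ _ _ _; exists (upd s out 0); split.
  + exact: exec_do.
  + by rewrite updE eqxx.
  + by move=> r _ /negPf ro; rewrite updE ro.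
- move=> /= -> ins out fr s _ _ _ sx;
    exists (upd (upd s out (s (ins ord0))) out (thead x).+1); split.
  + apply: exec_seq; first exact: exec_do.
    have := exec_do (Incr out) (upd s out (s (ins ord0))).
    by rewrite /= updE eqxx sx.
  + by rewrite updE eqxx.
  + by move=> r _ /negPf ro; rewrite !updE ro.
- move=> /= -> ins out fr s _ _ _ sx; exists (upd s out (s (ins i))); split.
  + exact: exec_do (Copy _ _) _.
  + by rewrite updE eqxx sx.
  + by move=> r _ /negPf ro; rewrite updE ro.
- move=> /= [v gv fv] ins out fr s lins lout nout sx.
  have [s1 [ex1 s1v s1s]] : exists s1,
     [/\ exec (foldr (fun i c => Seq (translate (g i) ins (fr + i) (fr + m)) c)
       Skip
                 (enum 'I_m)) s s1,
         forall i : 'I_m, s1 (fr + i) = tnth v i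
       & forall r, r < fr -> s1 r = s r].
    have [s1 [ex1 s1v s1s _]] : exists s1,
     [/\ exec (foldr (fun i c => Seq (translate (g i) ins (fr + i) (fr + m)) c)
       Skip
                 (enum 'I_m)) s s1,
         forall i : 'I_m, i \in enum 'I_m -> s1 (fr + i) = tnth v i,
         forall r, r < fr -> s1 r = s r
       & forall i : 'I_m, i \notin enum 'I_m -> s1 (fr + i) = s (fr + i)].
      elim: (enum 'I_m) (enum_uniq 'I_m) s sx => [_|i js IHjs /= /andP[ijs
        ujs]] s sx.
        by exists s; split=> //; apply: exec_skip.
      have [||||s1 [ex1 s1i s1s]] := IHg i _ _ (gv i) ins (fr + i) (fr + m) s.
      + by move=> j; rewrite ltn_addr.
      + by rewrite ltn_add2l.
      + by move=> j; rewrite neq_ltn ltn_addr.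
      + exact: sx.
      have s1s' r : r < fr -> s1 r = s r.
        by move=> lr; rewrite s1s ?ltn_addr // neq_ltn ltn_addr.
      have [|s2 [ex2 s2v s2s s2s']] := IHjs ujs s1; first by move=> j;
        rewrite s1s'.
      exists s2; split.
      + exact: exec_seq ex1 ex2.
      + move=> j; rewrite inE => /predU1P[->|]; last exact: s2v.
        by rewrite s2s'.
      + by move=> r lr; rewrite s2s // s1s'.
      + move=> j; rewrite inE negb_or => /andP[ji jjs].
        by rewrite s2s' // s1s ?ltn_add2l // eqn_add2l.
    by exists s1; split=> // i; rewrite s1v ?mem_enum.
  have [||||s2 [ex2 s2y s2s]] := IHf _ _ fv (fun i => fr + i) out (fr + m) s1.
  + by move=> i; rewrite ltn_add2l.
  + by rewrite ltn_addr.
  + by move=> i; rewrite neq_ltn orbC ltn_addr.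
  + exact: s1v.
  exists s2; split=> // [|r lr ro]; first exact: exec_seq ex1 ex2.
  by rewrite s2s ?ltn_addr // s1s.
- move=> /= xy ins out fr s lins lout nout sx.
  set xs := behead_tuple x in xy *.
  (* All intermediate values at once, in place of the nested existentials of [computes]. *)
  have {xy} [zs [zsy zs0 zsS]] : exists zs : nat -> nat, [/\ zs (thead x) = y,
      computes f xs (zs 0) & forall i, i < thead x ->
        computes g (cons_tuple i (cons_tuple (zs i) xs)) (zs i.+1)].
    elim: (thead x) y xy => [|k IHk] y; first by exists (fun=> y).
    case=> z /IHk [zs [<- zs0 zsS]] gy.
    exists (fun i => if i <= k then zs i else y); split=> //;
      first by rewrite ltnn.
    move=> i; rewrite ltnS => ik; rewrite ik; move: ik.
    by rewrite leq_eqVlt => /predU1P[->|ik]; [rewrite ltnn | rewrite ik;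
      apply: zsS].
  set tl := fun i => ins (lift ord0 i).
  have tl_s t : agree fr out s t -> forall i, t (tl i) = tnth xs i.
    by move=> st i; rewrite st ?lins ?nout // sx tnth_behead; congr tnth;
      apply: val_inj; rewrite /= inordK // ltnS.
  have [||||s1 [ex1 s1y s1s]] := IHf _ _ zs0 tl out fr s.
  + by move=> i; apply: lins.
  + exact: lout.
  + by move=> i; apply: nout.
  + by apply: tl_s.
  set s2 := upd (upd s1 fr (s1 (ins ord0))) fr.+1 0.
  have ne r : r < fr -> (r == fr = false) * (r == fr.+1 = false) * (r == fr.+2
    = false).
    by move=> lr; do !split; apply/eqP; lia.
  have ex2 : exec (Seq (Do (Copy fr (ins ord0))) (Do (Zero fr.+1))) s1 s2.
    by apply: exec_seq; [exact: exec_do | exact: exec_do (Zero _) _].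
  have loop j i t : thead x = i + j -> t fr = j -> t fr.+1 = i ->
    t out = zs i ->
      agree fr out s t -> exists s',
      [/\ exec (Loop fr (Seq (translate g (icons fr.+1 (icons out tl)) fr.+2
        fr.+3)
              (Seq (Do (Copy out fr.+2)) (Seq (Do (Incr fr.+1)) (Do (Decr
                fr)))))) t s',
          s' out = y & agree fr out s s'].
    elim: j i t => [|j IHj] i t xij tj ti tz st.
      by exists t; split=> //; [apply: exec_done | rewrite tz -zsy xij addn0].
    have lt : i < thead x by rewrite xij; lia.
    have [||||t1 [ext1 t1z t1t]] := IHg _ _ (zsS _ lt) (icons fr.+1 (icons out
      tl)) fr.+2 fr.+3 t.
    + apply: (iconsP (Q := fun r => r < _)); first by lia.
      by apply: (iconsP (Q := fun r => r < _)) => [|u]; [|have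
        := lins (lift ord0 u); rewrite /tl]; lia.
    + by [].
    + apply: (iconsP (Q := fun r => r != _)); first by lia.
      by apply: (iconsP (Q := fun r => r != _)) => [|u]; [|have
        := lins (lift ord0 u); rewrite /tl]; lia.
    + by do 2!apply: icons_store => //; apply: tl_s.
    set t2 := upd (upd (upd t1 out (t1 fr.+2)) fr.+1 i.+1) fr j.
    have ext2 : exec (Seq (Do (Copy out fr.+2)) (Seq (Do (Incr fr.+1)) (Do
      (Decr fr)))) t1 t2.
      have := exec_seq (exec_do (Copy out fr.+2) t1) (exec_seq (exec_do (Incr
        fr.+1) _) (exec_do (Decr fr) _)).
      have t1fr : t1 fr = j.+1 by rewrite t1t ?tj //; lia.
      have t1fr1 : t1 fr.+1 = i by rewrite t1t ?ti //; lia.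
      have fr1 : (fr == fr.+1) = false by apply/eqP; lia.
      by rewrite /= !updE fr1 ![_ == out]eq_sym !ne // t1fr t1fr1.
    have [|||||s' [ex' s'y s's]] := IHj i.+1 t2.
    + by rewrite xij addSnnS.
    + by rewrite /t2 !updE eqxx.
    + by rewrite /t2 !updE eqxx (_ : fr.+1 == fr = false) //; apply/eqP; lia.
    + by rewrite /t2 !updE eqxx !ne.
    + move=> r lr ro; rewrite /t2 !updE !ne // (negPf ro) t1t ?ne //.
      * exact: st.
      * by lia.
    exists s'; split=> //; apply: exec_loop ex'; first by rewrite tj.
    exact: exec_seq ext1 ext2.
  have [|||||s' [ex' s'y s's]] := loop (thead x) 0 s2.
  + by [].
  + rewrite /s2 !updE eqxx (_ : fr == fr.+1 = false); last by apply/eqP; lia.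
    by rewrite s1s ?lins ?nout // sx.
  + by rewrite /s2 updE eqxx.
  + by rewrite /s2 !updE !ne.
  + by move=> r lr ro; rewrite /s2 !updE !ne // s1s.
  by exists s'; split=> //; apply: exec_seq ex'; apply: exec_seq ex2.
- move=> /= [fy fz] ins out fr s lins lout nout sx.
  have ne : (out == fr) = false by apply/eqP; lia.
  have body i t : t out = i -> agree fr out s t -> forall w,
      computes f (cons_tuple i x) w -> exists t',
      [/\ exec (translate f (icons out ins) fr fr.+1) t t', t' fr = w,
          t' out = i & agree fr out s t'].
    move=> ti st w fw; have [||||t1 [ex1 t1w t1t]]
      := IHf _ _ fw (icons out ins) fr fr.+1 t.
    + by apply: (iconsP (Q := fun r => r < _)) => [|u]; [|have := lins u]; lia.
    + by [].
    + by apply: (iconsP (Q := fun r => r != _)) => [|u]; [rewrite ne|have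
        := lins u; lia].
    + by apply: icons_store => // j; rewrite st ?lins ?nout.
    exists t1; split=> //; first by rewrite t1t ?ne ?ltnS // ltnW.
    by move=> r lr ro; rewrite t1t ?st // ?neq_ltn ?lr // ltnS ltnW.
  have value i : i <= y -> exists w, computes f (cons_tuple i x) w.
    by rewrite leq_eqVlt => /predU1P[->|/fz[w fw]]; [exists 0 | exists w.+1].
  have loop j i t : y = i + j -> t out = i ->
    computes f (cons_tuple i x) (t fr) ->
      agree fr out s t -> exists s',
      [/\ exec (Loop fr (Seq (Do (Incr out)) (translate f (icons out ins) fr
        fr.+1))) t s',
          s' out = y & agree fr out s s'].
    elim: j i t => [|j IHj] i t yij ti fi st.
      exists t; split=> //; last by rewrite ti yij addn0.
      by apply: exec_done; apply: computes_functional fi _;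
        rewrite -[i]addn0 -yij.
    have [w fw] : exists w, computes f (cons_tuple i.+1 x) w by apply: value;
      lia.
    have [||t1 [ex1 t1w t1i st1]] := body i.+1 (upd t out i.+1) _ _ w fw.
    + by rewrite updE eqxx.
    + by move=> r lr ro; rewrite updE (negPf ro) st.
    have [||||s' [ex' s'y s's]] := IHj i.+1 t1; rewrite ?t1w //.
      by rewrite yij addSnnS.
    exists s'; split=> //; apply: exec_loop ex'.
      have [|u fu] := fz i; first by lia.
      by rewrite (computes_functional fi fu).
    by apply: exec_seq ex1; rewrite -ti; apply: exec_do (Incr _) _.
  have [w fw] := value 0 (leq0n _).
  have [||t1 [ex1 t1w t1i st1]] := body 0 (upd s out 0) _ _ w fw.
  + by rewrite updE eqxx.
  + by move=> r lr ro; rewrite updE (negPf ro).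
  have [||||s' [ex' s'y s's]] := loop y 0 t1; rewrite ?t1w //.
  exists s'; split=> //; apply: exec_seq ex'; apply: exec_seq ex1.
  exact: exec_do (Zero _) _.
Qed.

Definition search_store (x y : nat) : store :=
  fun r => if r == 0 then x else if r == 1 then y else 0.

(** The candidate [z] is in register 2, and the loop runs while register 3, which holds the negation
    of [R x y z], is nonzero. For divergence it suffices that the body is entered arbitrarily late,
    since a halted program never moves. *)
Lemma search_program (R : nat -> nat -> nat -> bool) :
  cmpb 3 (fun rho => R (rho 0) (rho 1) (rho 2)) ->
  exists P, forall x y,
    ((exists z, R x y z) ->
       exists k, size P <= (iter k (run1 P) (0, search_store x y)).1) /\
    ((forall z, ~~ R x y z) ->
       forall k, (iter k (run1 P) (0, search_store x y)).1 < size P).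
Proof.
move=> /cmpb_not[e eR].
pose C := translate e (fun i => i : nat) 3 4.
pose L := Loop 3 (Seq (Do (Incr 2)) C); pose I := Seq (Do (Zero 2)) C.
pose P := compile (Seq I L) 0; exists P => x y.
pose good z (s : store) := [/\ s 0 = x, s 1 = y, s 2 = z & s 3 = ~~ R x y z].
have execC z s : s 0 = x -> s 1 = y -> s 2 = z ->
    exists2 s', exec C s s' & good z s'.
  move=> s0 s1 s2; pose rho := scons x (scons y (scons z (fun=> 0))).
  have [||||s' [ex s'3 s's]] := translate_exec (eR rho)
    (ins := fun i => i : nat) (out := 3) (fr := 4) (s := s) => //.
  - by case=> -[|[|[|]]].
  - by case=> -[|[|[|]]].
  - by case=> -[|[|[|//]]] /= ?; rewrite tnth_env.
  - by exists s' => //; split; rewrite ?s'3 // s's.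
have [s1 exI good1] : exists2 s, exec I (search_store x y) s & good 0 s.
  have [|||s ex gs] := execC 0 (op_store (Zero 2) (search_store x y)) => //.
  by exists s => //; apply: exec_seq ex; apply: exec_do.
have execB z s : good z s -> exists2 s', exec (Seq (Do (Incr 2)) C) s s' & good
  z.+1 s'.
  case=> s_0 s_1 s_2 _.
  have [|||s' ex gs] := execC z.+1 (op_store (Incr 2) s);
    rewrite /= ?updE ?s_2 //.
  by exists s' => //; apply: exec_seq ex; apply: exec_do.
have lP : loads P 0 (compile (Seq I L) 0) by exists [::], [::]; rewrite cats0.
split=> [xyR|xyR k].
  pose z := ex_minn xyR.
  have loop j i s : i + j = z -> good i s -> exists s', exec L s s'.
    elim: j i s => [|j IHj] i s ijz gs.
      exists s; apply: exec_done; case: gs => _ _ _ ->.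
      move: ijz; rewrite /z addn0 => ->.
      by case: ex_minnP => m -> _.
    have [s' exs' gs'] := execB _ _ gs; have [|s'' ex''] := IHj i.+1 s' _ gs'.
      by rewrite addSnnS.
    exists s''; apply: exec_loop exs' ex''; case: gs => _ _ _ ->.
    case: (boolP (R x y i)) => // Ri; move: ijz; rewrite /z.
    by case: ex_minnP => m _ /(_ _ Ri); lia.
  have [s' exL] := loop z 0 s1 (add0n _) good1.
  by have [k kE] := compile_exec (exec_seq exI exL) lP; exists k; rewrite kE.
pose a := size (compile I 0).
have PE : P = compile I 0 ++ compile L a by [].
have lI : loads P 0 (compile I 0) by apply: (@loads_catl _ _ _ (compile L a));
  rewrite -PE.
have lL : loads P a (compile L a).
  by rewrite -[a in loads _ a]add0n; apply: loads_catr; rewrite -PE.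
have [lB run_a run_b] := loads_loop lL.
have aP : a.+1 < size P.
  by rewrite PE size_cat -/a -[X in X < _]addn1 ltn_add2l /= size_rcons.
have iter_a z : exists m s, [/\ z <= m, good z s & iter m (run1 P) (0,
  search_store x y) = (a.+1, s)].
  elim: z => [|z [m [s [zm gs mE]]]].
    have [m mE] := compile_exec exI lI.
    exists m.+1, s1; split=> //; rewrite iterS mE add0n -/a run_a.
    by case: good1 => _ _ _ ->; rewrite xyR.
  have [s' ex' gs'] := execB _ _ gs; have [j jE] := compile_exec ex' lB.
  exists (j.+1 + m), s'; split=> //;
    first by rewrite addSn ltnS (leq_trans zm) ?leq_addl.
  rewrite iterD mE iterS jE run_b.
  by case: gs' => _ _ _ ->; rewrite xyR.
rewrite ltnNge; apply/negP => halted.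
have [m [s [km _ mE]]] := iter_a k.
by move: aP; rewrite ltnNge -[a.+1]/(a.+1, s).1 -mE -(subnK km) iterD
  iter_run1_halted ?halted.
Qed.

Lemma op_below_leq K K' o : K <= K' -> op_below K o -> op_below K' o.
Proof.
move=> KK'; case: o => [r|r|r r'|r] /=; try by move=> /leq_trans; apply.
by case/andP=> lr lr'; rewrite !(leq_trans _ KK').
Qed.

Lemma program_below (P : seq instr) :
  exists2 K, 1 < K & all (fun i => op_below K i.1.1) P.
Proof.
elim: P => [|[[o q1] q2] P [K K_gt1 PK]]; first by exists 2.
have [Ko oKo] : exists Ko, op_below Ko o.
  case: o => [r|r|r r'|r]; try by exists r.+1 => /=.
  by exists (maxn r r').+1; rewrite /= !ltnS leq_maxl leq_maxr.
exists (maxn K Ko); first by rewrite leq_max K_gt1.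
rewrite /= (op_below_leq (leq_maxr _ _) oKo); apply: sub_all PK => i.
exact: op_below_leq (leq_maxl _ _).
Qed.

(** * Words: segments of cells run by one head *)

Section WordDynamics.
Variables (P : seq instr) (K X : nat).

Definition bits := {ffun 'I_K -> bool}.
Definition getb (f : bits) r := if insub r is Some i then f i else false.
Definition setb (f : bits) r b : bits :=
  [ffun i : 'I_K => if (i : nat) == r then b else f i].

Lemma getb_set f r b r' : r < K ->
  getb (setb f r b) r' = if r' == r then b else getb f r'.
Proof.
rewrite /getb; case: insubP => [i _ <-|]; first by rewrite ffunE.
by case: eqP => // -> /negPf ->.
Qed.

Lemma getb0 r : getb [ffun=> false] r = false.
Proof. by rewrite /getb; case: insub => // i; rewrite ffunE. Qed.

(* [s_far] marks the cells at distance at least [X] from the origin, [s_y]   *)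
(* the input in unary, [s_t] the remaining time, and track [r] of [s_bits]   *)
(* contains as many bits as the value of register [r].                       *)
Definition sym := (bool * bool * bool * bits)%type.
Definition s_far (s : sym) := s.1.1.1.
Definition s_y (s : sym) := s.1.1.2.
Definition s_t (s : sym) := s.1.2.
Definition s_bits (s : sym) := s.2.
Definition blank_sym far : sym := (far, false, false, [ffun=> false]).

(* [None] is the location of the routine that reloads inputs and timer.      *)
Definition location := option 'I_(size P).+1.
Definition loc (q : nat) : location := Some (inord (minn q (size P))).

(* [(q, Some (b, t))] moves right, executing [q] on each cell it visits; [b] *)
(* is the flag of the instruction and [t] tells whether a timer bit has been *)
(* consumed. [(q, None)] returns to the origin.                              *)
Definition hstate := (location * option (bool * bool))%type.

Definition op_cell o (b : bool) (f : bits) : bool * bits :=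
  match o with
  | Incr r => if b || getb f r then (b, f) else (true, setb f r true)
  | Decr r => if ~~ b && getb f r then (true, setb f r false) else (b, f)
  | Copy r r' => (b || getb f r', setb f r (getb f r'))
  | Zero r => (b, setb f r false)
  end.

Definition reload_bits (s : sym) : bits :=
  [ffun i : 'I_K => if (i : nat) == 0 then ~~ s_far s else ((i : nat) == 1) &&
    s_y s].

(** An instruction erases the first timer bit it meets, and no other. A reload sets all timer bits,
    so that the timer equals the length of the word. *)
Definition sweep1 (q : location) (bt : bool * bool) (s : sym) :
    (bool * bool) * sym :=
  if q is Some pc then
    let: (b, f) := op_cell (nth no_instr P pc).1.1 bt.1 (s_bits s) in
    ((b, bt.2 || s_t s), (s_far s, s_y s, s_t s && bt.2, f))
  else (bt, (s_far s, s_y s, true, reload_bits s)).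

(** A sweep that met no timer bit ends the run. A reload is repeated until the last cell is far,
    which guarantees that exactly [X] cells are near and register 0 receives [X]. *)
Definition sweep_end (q : location) (bt : bool * bool) (s : sym) : location :=
  if q is Some pc then
    let: (_, q1, q2) := nth no_instr P pc in
    if bt.2 then loc (if bt.1 then q1 else q2) else None
  else if s_far s then loc 0 else None.

Inductive move := Stay | Rightward | Leftward.

Definition head_step (h : hstate) (orig rend : bool) (s : sym) : hstate * sym *
  move :=
  match h with
  | (q, Some bt) => let: (bt', s') := sweep1 q bt s in
      if rend then ((sweep_end q bt' s, None), s', Stay)
      else ((q, Some bt'), s', Rightward)
  | (q, None) => if orig then ((q, Some (false, false)), s, Stay)
      else ((q, None), s, Leftward)
  end.

Definition head_halts (h : hstate) : bool :=
  if h is (Some pc, Some _) then (pc : nat) == size P else false.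

Definition word := (seq sym * nat * hstate)%type.

Definition halting (w : word) := (w.1.2 == 0) && head_halts w.2.

(** Every step of the head on the last cell appends a blank cell. Thus each sweep lengthens the
    word, and the next timer is larger. *)
Definition word_next (w : word) : word :=
  if halting w then w else
  let: (u, p, h) := w in
  let: (h', s', m) := head_step h (p == 0) (p == (size u).-1)
                        (nth (blank_sym false) u p) in
  let u1 := set_nth (blank_sym false) u p s' in
  (if p == (size u).-1 then rcons u1 (blank_sym (X <= size u)) else u1,
   match m with Stay => p | Rightward => p.+1 | Leftward => p.-1 end, h').

(* There is always room in the last cell for incrementing a register.        *)
Definition clean_end (u : seq sym) :=
  s_bits (last (blank_sym false) u) == [ffun=> false].

Definition far_ok (u : seq sym) := forall j, j < size u ->
  s_far (nth (blank_sym false) u j) = (X <= j).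

Definition wf (w : word) :=
  [/\ w.1.2 < size w.1.1, clean_end w.1.1 & far_ok w.1.1].

Definition yc (u : seq sym) := count s_y u.
Definition tc (u : seq sym) := count s_t u.
Definition rc (u : seq sym) : store
  := fun r => count (fun s => getb (s_bits s) r) u.

Lemma sweep1_far q bt s : s_far (sweep1 q bt s).2 = s_far s.
Proof. by rewrite /sweep1; case: q => // pc; case: op_cell. Qed.

Lemma sweep1_y q bt s : s_y (sweep1 q bt s).2 = s_y s.
Proof. by rewrite /sweep1; case: q => // pc; case: op_cell. Qed.

(** * Full sweeps as single machine steps *)

Fixpoint sweep q bt (u : seq sym) : (bool * bool) * seq sym :=
  if u is s :: u' then
    let: (bt1, s1) := sweep1 q bt s in
    let: (bt2, u2) := sweep q bt1 u' in (bt2, s1 :: u2)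
  else (bt, [::]).

Lemma size_sweep q bt u : size (sweep q bt u).2 = size u.
Proof.
elim: u bt => //= s u IHu bt; case: sweep1 => bt1 s1.
by have := IHu bt1; case: sweep => bt2 u2 /= ->.
Qed.

Lemma set_nth_cat_cons (T : Type) (x0 : T) l s r s' :
  set_nth x0 (l ++ s :: r) (size l) s' = l ++ s' :: r.
Proof. by elim: l => //= a l ->. Qed.

(** Stated from any position [size l], because an initial word may have its head anywhere. *)
Lemma sweep_go q l s r bt : (l = [::] -> ~~ head_halts (q, Some bt)) ->
  iter (size r).+1 word_next (l ++ s :: r, size l, (q, Some bt)) =
  (let: (bt', u) := sweep q bt (s :: r) in
   (l ++ rcons u (blank_sym (X <= size l + (size r).+1)), size l + size r,
    (sweep_end q bt' (last s r), None))).
Proof.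
elim: r l s bt => [|s' r IHr] l s bt nh.
  rewrite /= /word_next /halting ifF;
    last by case: l nh => //= /(_ erefl)/negPf.
  rewrite size_cat addn1 /= eqxx nth_cat ltnn subnn /=.
  case: sweep1 => bt' s1; rewrite addn0; congr (_, _, _).
  by rewrite set_nth_cat_cons -!cats1 -catA.
rewrite iterSr.
have -> : word_next (l ++ s :: s' :: r, size l, (q, Some bt)) =
    (rcons l (sweep1 q bt s).2 ++ s' :: r, size (rcons l (sweep1 q bt s).2),
     (q, Some (sweep1 q bt s).1)).
  rewrite /word_next /halting ifF; last by case: l nh => //= /(_ erefl)/negPf.
  rewrite size_cat /= addnS /= nth_cat ltnn subnn /=.
  rewrite (_ : size l == _ = false); last by apply/eqP; lia.
  case: sweep1 => bt' s1 /=; rewrite size_rcons.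
  by rewrite set_nth_cat_cons cat_rcons.
rewrite IHr; last by case: l {nh}.
rewrite [sweep q bt _]/=; case: (sweep1 q bt s) => bt1 s1 /=.
case: (sweep1 q bt1 s') => bt2 s2; case: sweep => bt3 u.
by rewrite size_rcons cat_rcons /= !addSnnS.
Qed.

Lemma back_nonhalting u p q : halting (u, p, (q, None)) = false.
Proof. by rewrite /halting; case: q => [pc|]; rewrite andbF. Qed.

Lemma back_go u p q : p.+1 < size u ->
  iter p.+1 word_next (u, p, (q, None)) = (u, 0, (q, Some (false, false))).
Proof.
elim: p => [|p IHp] lp.
  rewrite /= /word_next back_nonhalting /= ifF; last by apply/eqP; lia.
  congr (_, _, _); apply: (@eq_from_nth _ (blank_sym false)).
    by rewrite size_set_nth; lia.
  by move=> i _; rewrite nth_set_nth /=; case: eqP => // ->.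
rewrite iterSr (_ : word_next _ = (u, p, (q, None)));
  first by rewrite IHp // ltnW.
rewrite /word_next back_nonhalting /= ifF; last by apply/eqP; lia.
congr (_, _, _); apply: (@eq_from_nth _ (blank_sym false)).
  by rewrite size_set_nth; lia.
by move=> i _; rewrite nth_set_nth /=; case: eqP => // ->.
Qed.

Definition base u q : word := (u, 0, (q, Some (false, false))).

Definition reach w w' := exists m, w' = iter m word_next w.

Lemma reach_trans w1 w2 w3 : reach w1 w2 -> reach w2 w3 -> reach w1 w3.
Proof. by case=> m -> [m' ->]; exists (m' + m); rewrite iterD. Qed.

Lemma base_sweep u q : 0 < size u -> ~~ head_halts (q, Some (false, false)) ->
  exists2 m, 0 < m & iter m word_next (base u q) =
    let: (bt, u') := sweep q (false, false) u in
    base (rcons u' (blank_sym (X <= size u)))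
         (sweep_end q bt (last (blank_sym false) u)).
Proof.
case: u => // s r _ nh; exists ((size r).+1 + (size r).+1) => //.
rewrite iterD (@sweep_go q [::] s r) //.
have := size_sweep q (false, false) (s :: r).
case: sweep => bt u /= su; rewrite add0n -iterS back_go //.
by rewrite size_rcons su.
Qed.

Lemma head_stepP h orig rend s :
  let: (_, s', m) := head_step h orig rend s in
  [/\ s_far s' = s_far s, s_y s' = s_y s, m = Rightward -> ~~ rend
    & m = Leftward -> ~~ orig].
Proof.
case: h => q [bt|] /=; last by case: orig.
rewrite -(sweep1_far q bt s) -(sweep1_y q bt s).
by case: sweep1 => bt' s'; case: rend.
Qed.

Lemma nextP w : wf w ->
  [/\ wf (word_next w), yc (word_next w).1.1 = yc w.1.1 & size w.1.1 <= size
    (word_next w).1.1].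
Proof.
case: w => [[u p] h] [/= lp cu fu]; rewrite /word_next; case: ifP => // _.
have := head_stepP h (p == 0) (p == (size u).-1) (nth (blank_sym false) u p).
case: head_step => [[h' s'] m] [s'f s'y mR mL].
set u1 := set_nth _ u p s'; have su1 : size u1 = size u by rewrite
  size_set_nth; lia.
have fu1 : far_ok u1.
  move=> j; rewrite su1 nth_set_nth /= => lj.
  by case: eqP => [->|_]; rewrite ?s'f fu.
have yu1 : yc u1 = yc u.
  rewrite /yc -!(count_map s_y id); congr count.
  apply: (@eq_from_nth _ false); rewrite !size_map ?su1 // => j lj.
  by rewrite !(nth_map (blank_sym false)) ?su1 // nth_set_nth /=;
    case: eqP => // ->.
case: eqP mR => [pe|pe] mR; rewrite /wf /=.
  rewrite size_rcons su1 leqnSn /yc -cats1 count_cat -!/(yc _) yu1 /= !addn0.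
  split=> //; split.
  - by case: m mR mL => [_ _|/(_ erefl)//|_ _]; lia.
  - by rewrite /clean_end last_cat /=.
  - move=> j; rewrite size_cat su1 addn1 ltnS nth_cat su1 leq_eqVlt.
    case/predU1P=> [->|lj]; first by rewrite ltnn subnn.
    by rewrite lj fu1 ?su1.
rewrite su1 leqnn yu1; split=> //; split=> //.
  by case: m mR mL => [_ _|_ _|_ _]; lia.
rewrite /clean_end -nth_last su1 nth_set_nth /= ifF ?nth_last //.
by apply/eqP; lia.
Qed.

Lemma iter_nextP m w : wf w -> [/\ wf (iter m word_next w),
  yc (iter m word_next w).1.1 = yc w.1.1 & size w.1.1 <= size (iter m word_next
    w).1.1].
Proof.
move=> wfw; elim: m => //= m [/nextP[wf' yc' le'] yE le]; split=> //.
  by rewrite yc' yE.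
exact: leq_trans le le'.
Qed.

Lemma sweep_timer pc bt u :
  (sweep (Some pc) bt u).1.2 = bt.2 || (0 < tc u) /\
  tc (sweep (Some pc) bt u).2 = if bt.2 then tc u else (tc u).-1.
Proof.
elim: u bt => [|s u IHu] [b t] /=; first by rewrite orbF; case: t.
case: op_cell => b' f /=; have := IHu (b', t || s_t s).
case: sweep => bt2 u2 /= [-> ->]; rewrite /tc /= -/(tc u) -/(tc u2) /s_t /=.
by case: t; case: s => [[[? ?] []] ?] /=; rewrite ?andbF ?add1n ?orbT.
Qed.

(** The bits of a register may be scattered over the word. The flag [bt.1] selects the branch and
    also stops [Incr] and [Decr] after the first cell that they can change. *)
Lemma sweep_bits (pc : 'I_(size P).+1) bt u : let o
  := (nth no_instr P pc).1.1 in op_below K o ->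
  let: (bt', u') := sweep (Some pc) bt u in
  match o with
  | Incr r => bt'.1 = bt.1 || has (fun s => ~~ getb (s_bits s) r) u /\
      forall r', rc u' r' = rc u r' +
        ((r' == r) && ~~ bt.1 && has (fun s => ~~ getb (s_bits s) r) u)
  | Decr r => bt'.1 = bt.1 || (0 < rc u r) /\
      forall r', rc u' r' = if (r' == r)
        && ~~ bt.1 then (rc u r).-1 else rc u r'
  | Copy r r1 => bt'.1 = bt.1 || (0 < rc u r1) /\
      forall r', rc u' r' = if r' == r then rc u r1 else rc u r'
  | Zero r => bt'.1 = bt.1 /\
      forall r', rc u' r' = if r' == r then 0 else rc u r'
  end.
Proof.
move=> o oK; elim: u bt => [|s u IHu] [b t].
  rewrite /rc /=; case: o {oK} => [r|r|r r1|r] /=; rewrite ?orbF; split=> // r';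
    rewrite ?andbF //; by case: ifP.
rewrite /= -/o; case oE: (op_cell o b (s_bits s)) => [b' f].
have := IHu (b', t || s_t s); case: sweep => bt2 u2 /=.
case: o oK oE {IHu} => [r|r|r r1|r] /= oK.
- case: ifP => [bg [<- <-] [-> uE]|/negbT]; last first.
    rewrite negb_or => /andP[/negPf bF /negPf gF] [<- <-] [-> uE].
    rewrite bF gF /=; split=> // r'; rewrite  uE andbF /= addn0 /= getb_set //.
    by case: eqP => [->|]; rewrite ?gF ?addn0 //= ?add0n addnC.
  split=> [|r'].
    by case: (b) bg => //= ->.
  rewrite  uE addnA; congr (_ + nat_of_bool _).
  by case: (b) bg => /=; rewrite ?andbF // => ->.
- case: ifP => [/andP[/negPf bF gT] [<- <-] [-> uE]|bg [<- <-] [-> uE]].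
    rewrite bF gT add1n /=; split=> // r'.
    by rewrite  uE andbF /= getb_set // andbT; case: eqP => // ->.
  split=> [|r']; first by case: (b) bg => //= ->.
  rewrite  uE; case: ifP => //; case: eqP => //= ->.
  by case: (b) bg => //= ->.
- case=> <- <- [-> uE]; case/andP: oK => oK _; split=> [|r'].
    by rewrite addn_gt0 orbA; case: getb.
  by rewrite  uE getb_set //; case: eqP => // ->.
- case=> <- <- [-> uE]; split=> // r'.
  by rewrite  uE getb_set //; case: eqP.
Qed.

Hypotheses (K_gt1 : 1 < K) (P_below : all (fun i => op_below K i.1.1) P).

Lemma loc_val q : (inord (minn q (size P)) : 'I_(size P).+1) = minn q (size P)
  :> nat.
Proof. by rewrite inordK // ltnS geq_minr. Qed.

Lemma halting_loc u pc : halting (base u (loc pc)) = (size P <= pc).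
Proof. by rewrite /halting /= loc_val; apply/eqP/idP; lia. Qed.

Lemma rc_rcons_blank u far : rc (rcons u (blank_sym far)) = rc u.
Proof.
by apply: funext => r; rewrite /rc -cats1 count_cat /= getb0 !addn0.
Qed.

Lemma tc_rcons_blank u far : tc (rcons u (blank_sym far)) = tc u.
Proof. by rewrite /tc -cats1 count_cat /= !addn0. Qed.

(** The clean last cell always has room for [Incr]. With an empty timer the operation is still
    performed; only the next location changes. *)
Lemma macro_instr u pc : wf (base u (loc pc)) -> pc < size P ->
  exists2 m, 0 < m & exists u', [/\ iter m word_next (base u (loc pc)) =
      base u' (if 0 < tc u then loc (run1 P (pc, rc u)).1 else None),
    rc u' = (run1 P (pc, rc u)).2, tc u' = (tc u).-1 & size u' = (size u).+1].
Proof.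
case=> /= u_gt0 cu fu lpc; have pcE := loc_val pc;
  rewrite [RHS](minn_idPl (ltnW lpc)) in pcE.
have [|m m_gt0 mE] := @base_sweep u (loc pc) u_gt0.
  by rewrite /= pcE ltn_eqF.
exists m => //; rewrite {}mE; have oK : op_below K (nth no_instr P pc).1.1.
  exact: (all_nthP no_instr P_below).
rewrite /run1 /= lpc; set pcl := inord _ in pcE *.
have room r : has (fun s => ~~ getb (s_bits s) r) u.
  apply/hasP; exists (last (blank_sym false) u); last by rewrite (eqP cu) getb0.
  by case: (u) u_gt0 => //= s v _; apply: mem_last.
have := sweep_timer pcl (false, false) u; have
  := @sweep_bits pcl (false, false) u.
have := size_sweep (Some pcl) (false, false) u.
rewrite pcE; case: sweep => bt u' /= su' /(_ oK) uE [tE tuE].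
exists (rcons u' (blank_sym (X <= size u))).
rewrite rc_rcons_blank tc_rcons_blank size_rcons su' tE tuE.
case: nth oK uE => [[o q1] q2] /= oK uE; split=> //.
  congr base; case: ifP => // _; congr (loc (if _ then _ else _)).
  by case: o oK uE => [r|r|r r1|r] /= oK [-> _] //; rewrite room.
apply: funext => r'; case: o oK uE => [r|r|r r1|r] /= oK [_ ->];
  rewrite updE ?andbT //.
by rewrite room andbT; case: eqP => [->|_]; rewrite ?addn1 ?addn0.
Qed.

Lemma sweep_reload bt u : sweep None bt u =
  (bt, [seq (s_far s, s_y s, true, reload_bits s) | s <- u]).
Proof. by elim: u => //= s u ->. Qed.

Lemma count_near u : far_ok u -> X <= size u ->
  count (fun s => ~~ s_far s) u = X.
Proof.
move=> fu lu; rewrite -[RHS](sum_ltn lu) -sum1_count (big_nth (blank_sym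
  false)).
rewrite big_mkord big_mkcond; apply: eq_bigr => i _.
by rewrite fu // -ltnNge; case: ifP.
Qed.

Lemma macro_reload u : wf (base u None) ->
  exists2 m, 0 < m & exists u', [/\ iter m word_next (base u None) =
      base u' (if X < size u then loc 0 else None),
    X < size u -> rc u' = search_store X (yc u), tc u' = size u
    & size u' = (size u).+1].
Proof.
case=> /= u_gt0 cu fu; have [//|m m_gt0 mE] := @base_sweep u None u_gt0.
exists m => //; rewrite {}mE sweep_reload.
exists (rcons [seq (s_far s, s_y s, true, reload_bits s) | s <- u]
          (blank_sym (X <= size u))); split; first 1 last.
- move=> Xu; rewrite rc_rcons_blank; apply: funext => r;
    rewrite /rc count_map /search_store.
  rewrite -[X in if _ then X else _](count_near fu (ltnW Xu)).
  case: ifP => [/eqP->|r0]; [|case: ifP => [/eqP->|r1]].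
  + apply: eq_count => s /=; rewrite /getb insubT; first by lia.
    by move=> K0; rewrite ffunE.
  + by apply: eq_count => s /=; rewrite /getb insubT; rewrite ffunE.
  + apply/eqP; rewrite eqn0Ngt -has_count; apply/hasPn => s _ /=.
    rewrite /getb; case: insubP => // i _ iE.
    by rewrite ffunE iE r0 r1.
- by rewrite tc_rcons_blank /tc count_map /= -[RHS](count_predT u).
- by rewrite size_rcons size_map.
- congr base; rewrite /= -nth_last fu; last by lia.
  by rewrite (_ : (X <= _) = (X < size u)) //; lia.
Qed.

Definition eventually_halts w := exists m, halting (iter m word_next w).

Lemma eventually_halts_reach w w' : reach w w' ->
  eventually_halts w' -> eventually_halts w.
Proof. by case=> m -> [m' hm]; exists (m' + m); rewrite iterD. Qed.

Lemma reach_wf w w' : reach w w' -> wf w -> wf w' /\ yc w'.1.1 = yc w.1.1.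
Proof. by case=> m -> /(iter_nextP m)[]. Qed.

(** Nothing is assumed of the registers and the location: the timer alone forces either halting or a
    return to the reload routine. *)
Lemma timed_run k u pc : tc u = k -> wf (base u (loc pc)) ->
  eventually_halts (base u (loc pc)) \/
  exists u', [/\ reach (base u (loc pc)) (base u' None), size u < size u'
    & forall n, n <= k -> (iter n (run1 P) (pc, rc u)).1 < size P].
Proof.
elim: k u pc => [|k IHk] u pc uk wfu; (case: (leqP (size P) pc) => [halt|lpc];
  first by left; exists 0; rewrite /= halting_loc);
  have [m _ [u' [mE rE tE sE]]] := macro_instr wfu lpc.
  right; exists u'; split; first by exists m; rewrite mE uk.
    by rewrite sE.
  by case.
rewrite uk /= in mE tE.
have rch : reach (base u (loc pc)) (base u' (loc (run1 P (pc, rc u)).1)) by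
  exists m.
have [wfu' _] := reach_wf rch wfu.
have [ev|[v [rch' lt run]]] := IHk u' _ tE wfu'.
  by left; apply: eventually_halts_reach ev.
right; exists v; split; first exact: reach_trans rch'.
  by apply: leq_ltn_trans lt; rewrite sE.
case=> // n nk; rewrite iterSr; have := run n nk.
by rewrite rE -surjective_pairing.
Qed.

Section Halting.
Hypothesis P_halts : forall y, exists n,
  size P <= (iter n (run1 P) (0, search_store X y)).1.

Lemma reload_halts u : wf (base u None) -> eventually_halts (base u None).
Proof.
have [N NP] := P_halts (yc u); move yE : (yc u) NP => y NP.
(* A word of length [N + X + 1] loads its inputs in one sweep and has time for the [N] steps to
   halting; [j] bounds the length still missing. *)
have : N + X + 1 <= size u + (N + X + 1) by rewrite leq_addl.
move: {2}(N + X + 1) => j; elim: j u yE => [|j IHj] u yE lu wfu;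
  have [m _ [u' [mE rE tE sE]]] := macro_reload wfu;
  have rch : reach (base u None) (base u' (if X < size u then loc 0 else None))
    by exists m.
- have Xu : X < size u by lia.
  rewrite Xu in rch; have [wfu' _] := reach_wf rch wfu.
  apply: (eventually_halts_reach rch).
  have [//|[v [_ _ run]]] := timed_run tE wfu'.
  have := run N; rewrite rE // yE => /(_ _); rewrite ltnNge NP.
  by move=> /(_ ltac:(lia)).
- have [wfu' /= yu'] := reach_wf rch wfu.
  apply: (eventually_halts_reach rch); case: ifP wfu' => Xu wfu'; last first.
    by apply: IHj => //; rewrite ?yu' //; lia.
  have [//|[v [rch' lt _]]] := timed_run tE wfu'.
  have [wfv /= yv] := reach_wf rch' wfu'.
  apply: (eventually_halts_reach rch'); apply: IHj => //; last by lia.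
  by rewrite yv yu'.
Qed.

Lemma base_halts u q : wf (base u q) -> eventually_halts (base u q).
Proof.
case: q => [pc|]; last exact: reload_halts.
have -> : Some pc = loc pc.
  by congr Some; apply: val_inj; rewrite /= loc_val; case: pc => /= pc; lia.
move=> wfu; have [//|[v [rch _ _]]] := timed_run (erefl _) wfu.
apply: (eventually_halts_reach rch); apply: reload_halts.
by have [] := reach_wf rch wfu.
Qed.

Lemma back_halts u p q : wf (u, p, (q, None)) ->
  eventually_halts (u, p, (q, None)).
Proof.
have main u' p' : wf (u', p', (q, None)) -> p'.+1 < size u' ->
    eventually_halts (u', p', (q, None)).
  move=> wfu lt; have rch : reach (u', p', (q, None)) (base u' q).
    by exists p'.+1; rewrite back_go.
  by apply: (eventually_halts_reach rch); apply: base_halts; have []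
    := reach_wf rch wfu.
move=> wfu; have [/= lp _ _] := wfu.
have [lt|ge] := ltnP p.+1 (size u); first exact: main.
have pE : p = (size u).-1 by lia.
have rch : reach (u, p, (q, None)) (word_next (u, p, (q, None))) by exists 1.
have [wfn _] := reach_wf rch wfu.
apply: (eventually_halts_reach rch); move: wfn.
rewrite /word_next back_nonhalting /= -pE eqxx; case: eqP => [->|p0] wfn.
  exact: base_halts.
by apply: main => //; rewrite size_rcons size_set_nth; lia.
Qed.

Lemma word_halts w : wf w -> eventually_halts w.
Proof.
case: w => [[u p] [q [bt|]]] wfu; last exact: back_halts.
have [/= lp _ _] := wfu.
have [hw|/negP nh] := boolP (halting (u, p, (q, Some bt))); first by exists 0.
set s := nth (blank_sym false) u p.
have uE : u = take p u ++ s :: drop p.+1 u by rewrite -drop_nth //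
  cat_take_drop.
have sp : size (take p u) = p by rewrite size_take lp.
have nh' : take p u = [::] -> ~~ head_halts (q, Some bt).
  move=> t0; apply/negP => hh; apply: nh; rewrite /halting hh andbT /=.
  by rewrite -sp t0.
have [u2 [p2 [q2 rch]]] : exists u2 p2 q2, reach (u, p, (q, Some bt)) (u2, p2,
  (q2, None)).
  have := sweep_go s (drop p.+1 u) nh'; rewrite sp -uE.
  by case: sweep => bt' u' goE; do 3!eexists; exists (size (drop p.+1 u)).+1;
    rewrite goE.
apply: (eventually_halts_reach rch); apply: back_halts.
by have [] := reach_wf rch wfu.
Qed.

End Halting.

Section Survival.
Variable y : nat.
Hypothesis P_runs : forall n,
  (iter n (run1 P) (0, search_store X y)).1 < size P.

(** Either reloading, or at the start of a sweep within the genuine computation on [X] and [y]. *)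
Definition legal w := wf w /\ exists u, yc u = y /\ (w = base u None \/
  exists n, w = base u (loc (iter n (run1 P) (0, search_store X y)).1) /\
    rc u = (iter n (run1 P) (0, search_store X y)).2).

Lemma legal_step w : legal w -> ~~ halting w /\
  exists2 m, 0 < m & legal (iter m word_next w).
Proof.
case=> wfw [u [yu [wE|[n [wE rE]]]]]; subst w; split.
- by rewrite /halting.
- have [m m_gt0 [u' [mE rE tE sE]]] := macro_reload wfw.
  exists m => //; have [wf' yE _] := iter_nextP m wfw.
  split=> //; exists u'; rewrite mE in yE *; split; first by rewrite -yu -yE.
  case: ifP rE => [_ /(_ isT) rE|_ _]; last by left.
  by right; exists 0; rewrite rE yu.
- by rewrite halting_loc -ltnNge.
- have [m m_gt0 [u' [mE rE' tE sE]]] := macro_instr wfw (P_runs n).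
  exists m => //; have [wf' yE _] := iter_nextP m wfw.
  split=> //; exists u'; rewrite mE in yE *; split; first by rewrite -yu -yE.
  case: ifP => _; last by left.
  by right; exists n.+1; rewrite iterS rE' rE -surjective_pairing.
Qed.

(** Halting words are fixed by [word_next], so it is enough that [legal] words, which do not halt,
    recur arbitrarily late. *)
Lemma word_survives u m : wf (base u None) -> yc u = y ->
  ~~ halting (iter m word_next (base u None)).
Proof.
move=> wfu yu; have leg j : exists2 k, j <= k & legal (iter k word_next (base u
  None)).
  elim: j => [|j [k jk /legal_step[_ [i i_gt0 leg]]]].
    by exists 0 => //; split=> //; exists u; split=> //; left.
  by exists (i + k); [lia | rewrite iterD].
have [k mk /legal_step[nh _]] := leg m.
apply: contra nh => hm; rewrite -(subnK mk) iterD.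
by elim: (k - m) => //= i hi; rewrite /word_next hi.
Qed.

End Survival.
End WordDynamics.

(** * The cellular automaton on a line *)

Lemma ltn_predF p : (p < p.-1) = false.
Proof. by rewrite ltnNge leq_pred. Qed.

Lemma eqn_predF p : 0 < p -> (p == p.-1) = false.
Proof. by case: p => // p _; rewrite /= gtn_eqF. Qed.

Section LineDynamics.
Variables (P : seq instr) (K X : nat).
Hypothesis X_gt0 : 0 < X.

Local Notation sym := (sym K).
Local Notation hstate := (hstate P).
Local Notation word := (word P K).
Local Notation blank_sym := (@blank_sym K).
Local Notation halting := (@halting P K).
Local Notation word_next := (@word_next P K X).
Local Notation wf := (@wf P K X).
Local Notation far_ok := (@far_ok K X).
Local Notation head_step := (@head_step P K).

(* The two booleans mark the first and the last cell of a word. The last     *)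
(* component is the head, or tells whether the head is to the left.          *)
Definition cell := (bool * bool * sym * (hstate + bool))%type.
Definition c_orig (a : cell) := a.1.1.1.
Definition c_end (a : cell) := a.1.1.2.
Definition c_sym (a : cell) := a.1.2.
Definition c_hd (a : cell) := a.2.

Definition is_orig (a : option cell) := if a is Some a then c_orig a else false.
Definition here a := if c_hd a is inl _ then true else false.
Definition head_left a := if c_hd a is inr b then b else false.
Definition head_right a := if c_hd a is inr b then ~~ b else false.

Definition cell_step a : option (hstate * sym * move) :=
  if c_hd a is inl h then Some (head_step h (c_orig a) (c_end a) (c_sym a))
    else None.

Definition emits_left a : option hstate :=
  if cell_step a is Some (h, _, Leftward) then Some h else None.

Definition emits_right a : option hstate :=
  if cell_step a is Some (h, _, Rightward) then Some h else None.

Definition new_hd (l : option cell) a (r : option cell) : hstate + bool :=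
  match cell_step a with
  | Some (h, _, Stay) => inl h
  | Some (_, _, Rightward) => inr false
  | Some (_, _, Leftward) => inr true
  | None => if (if head_left a then obind emits_right l else obind emits_left r)
              is Some h then inl h else c_hd a
  end.

Definition new_sym a : sym := if cell_step a is Some (_, s, _) then s else
  c_sym a.

Definition new_cell l a r : cell :=
  (c_orig a, c_end a && ~~ here a, new_sym a, new_hd l a r).

Definition link b a :=
  [&& ~~ c_end b, ~~ c_orig a &
    if head_right b then here a || head_right a else head_left a].

(** In order: the left side is linked, with two cells there unless the neighbor is an origin; the
    right side is linked, or the cell is a proper end, with a free place for a birth if the head is
    there; the head is not to the left of the origin; the distance mark agrees with the far
    neighbor; the word has not halted. *)
Definition cell_ok (ll l : option cell) a (r far : option cell) :=
  [&& c_orig a || (if l is Some b then link b a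
    && (c_orig b || isSome ll) else false),
      if c_end a then
        [&& here a ==> ~~ isSome r, ~~ head_right a
          & s_bits (c_sym a) == [ffun=> false]]
      else if r is Some b then link a b else false,
      c_orig a ==> ~~ head_left a,
      s_far (c_sym a) == (is_orig far ||
         (~~ c_orig a && if l is Some b then s_far (c_sym b) else false))
    & ~~ (c_orig a && if c_hd a is inl h then head_halts h else false)].

Definition birth (b : cell) far : cell :=
  (false, true, blank_sym (is_orig far || s_far (c_sym b)), inr true).

(* A cell survives only if it is consistent with its neighbors. Since a cell *)
(* that is not an origin needs its two left neighbors (or one of them, an    *)
(* origin), a word without origin loses two cells on the left whenever it    *)
(* gains one on the right.                                                   *)
Definition line_rule (ll l c r far : option cell) : option cell :=
  match c with
  | Some a => if cell_ok ll l a r far then Some (new_cell l a r) else None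
  | None => if l is Some b then
      if [&& c_end b, here b & c_orig b || isSome ll] then Some (birth b far)
        else None
      else None
  end.

Definition line := int -> option cell.

Definition line_next (c : line) : line := fun i =>
  line_rule (c (i - 2)%R) (c (i - 1)%R) (c i) (c (i + 1)%R) (c (i - X%:Z)%R).

Definition ok_at (c : line) i := if c i is Some a then
  cell_ok (c (i - 2)%R) (c (i - 1)%R) a (c (i + 1)%R) (c (i - X%:Z)%R) else
    false.

Definition cell_at (w : word) (j : nat) : cell :=
  let: (u, p, h) := w in
  (j == 0, j == (size u).-1, nth (blank_sym false) u j,
   if j < p then inr false else if j == p then inl h else inr true).

Arguments cell_at : simpl never.

Definition matches (o : int) (w : word) (c : line) :=
  forall j, j < size w.1.1 -> c (o + j%:Z)%R = Some (cell_at w j).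

Lemma line_next_ok c i : ok_at c i -> exists2 a, c i = Some a &
  line_next c i = Some (new_cell (c (i - 1)%R) a (c (i + 1)%R)).
Proof. by rewrite /ok_at /line_next /line_rule; case: (c i) => // a ->;
  exists a. Qed.

Lemma line_next_nok c i : isSome (c i) -> ~~ ok_at c i -> line_next c i = None.
Proof.
by rewrite /ok_at /line_next /line_rule; case: (c i) => // a _ /negPf ->.
Qed.

Lemma line_next_orig c i : is_orig (line_next c i) -> is_orig (c i).
Proof.
rewrite /line_next /line_rule; case: (c i) => [a|]; first by case: ifP.
by case: (c (i - 1)%R) => // b; case: ifP.
Qed.

(** Whatever lies to the right is harmless, since a consistent last cell bearing the head has a free
    place next to it. Without origins on the left, the far neighbor gives a newborn cell its correct
    distance mark. *)
Lemma matches_next o w c : wf w -> matches o w c ->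
  (forall j, j < size w.1.1 -> ok_at c (o + j%:Z)%R) ->
  (forall i, (i < o)%R -> ~~ is_orig (c i)) ->
  ~~ halting w /\ matches o (word_next w) (line_next c).
Proof.
case: w => [[u p] h] [/= lp cu fu] mc okc no.
have nh : ~~ halting (u, p, h).
  have u_gt0 : 0 < size u by lia.
  apply/negP => /andP[/eqP /= p0 hh]; have := okc 0 u_gt0;
    rewrite /ok_at (mc 0 u_gt0).
  by case/and5P => _ _ _ _; rewrite /c_orig /c_hd /= p0 /= hh.
split=> //; rewrite /word_next (negPf nh).
have := head_stepP h (p == 0) (p == (size u).-1) (nth (blank_sym false) u p).
case stepE: head_step => [[h' s'] m] [s'f s'y mR mL].
have cell_p : cell_step (cell_at (u, p, h) p) = Some (h', s', m).
  by rewrite /cell_step /= ltnn eqxx /c_orig /c_end /c_sym /= stepE.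
have cell_np j : j != p -> cell_step (cell_at (u, p, h) j) = None.
  by move=> /negPf jp; rewrite /cell_step /= jp; case: ifP.
set u1 := set_nth _ u p s'; have su1 : size u1 = size u by rewrite
  size_set_nth; lia.
move=> j; set u2 := if _ then _ else _.
have su2 : size u2 = size u + (p == (size u).-1).
  by rewrite /u2; case: eqP; rewrite ?size_rcons su1 ?addn1 ?addn0.
have u2E i : i < size u -> nth (blank_sym false) u2 i =
    if i == p then s' else nth (blank_sym false) u i.
  by move=> li; rewrite /u2; case: ifP => _;
    rewrite ?nth_rcons ?su1 ?li nth_set_nth.
rewrite [size _]/= => lj.
have [ju|ju] := ltnP j (size u).
  have [a] := line_next_ok (okc j ju); rewrite mc // => /Some_inj <- ->;
    congr Some.
  have lE : 0 < j -> c (o + j%:Z - 1)%R = Some (cell_at (u, p, h) j.-1).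
    by move=> j0; rewrite -mc /=; [congr c|]; lia.
  have rE : j.+1 < size u -> c (o + j%:Z + 1)%R = Some (cell_at (u, p, h) j.+1).
    by move=> j0; rewrite -mc /=; [congr c; lia|].
  have emit f x : obind f (Some x) = f x :> option hstate by [].
  have emL : emits_left (cell_at (u, p, h) j.+1) =
      if (j.+1 == p) && (if m is Leftward then true else false) then Some h'
        else None.
    rewrite /emits_left; case: eqP => [->|/eqP/cell_np -> //]; rewrite cell_p.
    by case: (m).
  have emR : emits_right (cell_at (u, p, h) j.-1) =
      if (j.-1 == p) && (if m is Rightward then true else false) then Some h'
        else None.
    rewrite /emits_right; case: eqP => [->|/eqP/cell_np -> //]; rewrite cell_p.
    by case: (m).
  rewrite /new_cell /new_sym /new_hd; have [jp|pj|jp] := ltngtP j p.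
  - rewrite cell_np; last by rewrite ltn_eqF.
    rewrite rE; last by lia.
    rewrite emit emL /cell_at /c_orig /c_end /here /head_left /c_hd /c_sym /=.
    rewrite jp /= u2E // (ltn_eqF jp) andbT; congr (_, _, _, _).
      by rewrite su2; apply/eqP/eqP; lia.
    case: (m) => /=; rewrite ?andbF ?andbT;
      move: jp lp; clear => jp lp; repeat (case: ifP => ? //); exfalso; lia.
  - rewrite cell_np; last by rewrite gtn_eqF.
    rewrite lE; last by lia.
    rewrite emit emR /cell_at /c_orig /c_end /here /head_left /c_hd /c_sym /=.
    have jp : (j < p) = false by lia.
    rewrite jp (gtn_eqF pj) /= u2E // (gtn_eqF pj) andbT; congr (_, _, _, _).
      by rewrite su2; apply/eqP/eqP; lia.
    case: (m) => /=; rewrite ?andbF ?andbT;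
      move: pj lp; clear => pj lp; repeat (case: ifP => ? //); exfalso; lia.
  - rewrite jp cell_p /cell_at /c_orig /c_end /here /c_hd /= ltnn eqxx u2E //
      eqxx andbF.
    congr (_, _, _, _).
      by rewrite su2; apply/esym/eqP; lia.
    case: m {stepE cell_p emL emR} mR mL => mR mL.
    + by rewrite ltnn eqxx.
    + by rewrite ltnSn.
    + have p0 : p != 0 by apply: mL.
      by rewrite ltn_predF eqn_predF ?lt0n.
(* The remaining [j] is the newborn cell, so the head is on the old last cell. *)
have pE : p = (size u).-1 by move: lj; rewrite su2; case: eqP; lia.
have {lj} jE : j = size u by move: lj; rewrite su2; lia.
have u2j : nth (blank_sym false) u2 j = blank_sym (X <= size u).
  by rewrite /u2 pE eqxx nth_rcons su1 jE ltnn eqxx.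
have cp := mc p lp.
have cjE : c (o + j%:Z)%R = None.
  have := okc p lp; rewrite /ok_at cp => /and5P[_ + _ _ _].
  rewrite /c_end /here /c_hd /= {1}pE eqxx ltnn eqxx => /and3P[+ _ _].
  by rewrite (_ : (o + p%:Z + 1)%R = (o + j%:Z)%R); [case: (c _) | lia].
have clE : c (o + j%:Z - 1)%R = Some (cell_at (u, p, h) p).
  by rewrite -cp; congr c; lia.
rewrite /line_next /line_rule cjE clE.
have -> : [&& c_end (cell_at (u, p, h) p), here (cell_at (u, p, h) p)
   & c_orig (cell_at (u, p, h) p) || isSome (c (o + j%:Z - 2)%R)].
  rewrite /c_end /here /c_hd /c_orig /= {1}pE eqxx ltnn eqxx /=.
  case: eqP => //= p0; rewrite (_ : (o + j%:Z - 2)%R = (o + (p.-1)%:Z)%R);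
    last by lia.
  by rewrite mc //=; lia.
congr Some; rewrite /birth /cell_at u2j su2 pE eqxx addn1 jE.
have u_gt0 : 0 < size u by lia.
congr (_, _, _, _).
- by apply/esym/eqP; lia.
- by rewrite /= eqxx.
- congr blank_sym; rewrite /c_sym /= fu; last by lia.
  have [ltX|gtX|eqX] := ltngtP X (size u).
  + have -> : X <= (size u).-1 by lia.
    by rewrite orbT.
  + have -> : (X <= (size u).-1) = false by lia.
    by rewrite orbF; apply/negbTE/no; lia.
  + rewrite (_ : (o + (size u)%:Z - X%:Z)%R = (o + 0%:Z)%R); last by lia.
    by rewrite mc.
- case: m {stepE cell_p} mR mL => mR mL.
  + by rewrite ltnNge leq_pred gtn_eqF // ltn_predL.
  + by have := mR erefl; rewrite pE eqxx.
  + have lt : (size u).-1.-1 < size u by move: u_gt0; clear; lia.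
    by rewrite ltnNge (ltnW lt) gtn_eqF.
Qed.

Lemma c_orig_at w j : c_orig (cell_at w j) = (j == 0).
Proof. by case: w => -[]. Qed.

Lemma c_end_at w j : c_end (cell_at w j) = (j == (size w.1.1).-1).
Proof. by case: w => -[]. Qed.

Lemma c_sym_at w j : c_sym (cell_at w j) = nth (blank_sym false) w.1.1 j.
Proof. by case: w => -[]. Qed.

(** * A word alone on the line *)

Definition alone (o : int) (w : word) (c : line) := matches o w c /\
  forall i, (i < o)%R || (o + (size w.1.1)%:Z <= i)%R -> c i = None.

Lemma link_cell_at (w : word) j : j.+1 < size w.1.1 ->
  link (cell_at w j) (cell_at w j.+1).
Proof.
case: w => [[u p] h] /= lj; rewrite /link /head_right /head_left /here.
rewrite /cell_at /c_end /c_orig /c_hd /=; apply/andP; split;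
  first by apply/eqP; lia.
by case: (ltngtP j p) => jp /=; do ?case: ifP; lia.
Qed.

Lemma alone_ok o w c : wf w -> alone o w c -> ~~ halting w ->
  forall j, j < size w.1.1 -> ok_at c (o + j%:Z)%R.
Proof.
case: w => [[u p] h] [/= lp cu fu] [mc out] nh j; rewrite [size _]/= => lj;
  rewrite /ok_at (mc j lj).
have rE : j.+1 < size u -> c (o + j%:Z + 1)%R = Some (cell_at (u, p, h) j.+1).
  by move=> j0; rewrite -mc /=; [congr c; lia|].
have lE : j != 0 -> exists2 i, j = i.+1 & c (o + j%:Z - 1)%R = Some (cell_at
  (u, p, h) i).
  by case: j lj {rE} => // i li _; exists i => //; rewrite -mc /=; [congr c|];
    lia.
rewrite /cell_ok; apply/and5P; split.
- have [-> //|j0] := eqVneq j 0; have [i jE ->] := lE j0.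
  rewrite jE link_cell_at -?jE // andTb; apply/orP; right; apply/orP.
  case: i jE {rE lE} => [|i] jE; first by left.
  right; rewrite (_ : (o + j%:Z - 2)%R = (o + i%:Z)%R); last by lia.
  by rewrite mc //=; lia.
- rewrite c_end_at c_sym_at /=; case: eqP => jE; last first.
    have j1 : j.+1 < size u by lia.
    by rewrite rE // link_cell_at.
  rewrite out ?implybT /=; last by apply/orP; right; lia.
  rewrite /head_right /c_hd /cell_at /= jE nth_last (eqP cu) eqxx andbT.
  by have -> : ((size u).-1 < p) = false by [lia]; case: ifP.
- rewrite c_orig_at /head_left /c_hd /cell_at; case: eqP => //= ->.
  by case: ifP => // p0; case: ifP => // /negP; lia.
- rewrite c_sym_at c_orig_at /= fu //; apply/eqP.
  have [jX|Xj|jX] := ltngtP j X.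
  + rewrite out /=; last by apply/orP; left; lia.
    have [//|j0] := eqVneq j 0; have [i jE ->] := lE j0.
    by rewrite c_sym_at /= fu; lia.
  + have [|i jE ->] := lE _; first by lia.
    rewrite c_sym_at /= fu; last by lia.
    have -> : X <= i by lia.
    by rewrite andbT (_ : j != 0) ?orbT //; lia.
  + rewrite jX (_ : (o + X%:Z - X%:Z)%R = (o + 0%:Z)%R); last by lia.
    rewrite mc; last by rewrite /=; lia.
    by rewrite /is_orig c_orig_at.
- apply: contra nh; rewrite /cell_at /c_orig /c_hd /= /halting /=.
  case: eqP => //= ->; case: (p) => //=.
Qed.

Lemma alone_next o w c : wf w -> alone o w c -> ~~ halting w ->
  alone o (word_next w) (line_next c).
Proof.
move=> wfw al nh; have okc := alone_ok wfw al nh; case: (al) => mc out.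
have no i : (i < o)%R -> ~~ is_orig (c i) by move=> lt; rewrite out ?lt.
have [_ mc'] := matches_next wfw mc okc no.
split=> // i; have [_ _ sz] := nextP wfw => iout.
have ci : c i = None by apply: out; case/orP: iout => [->//|le]; apply/orP;
  right; lia.
rewrite /line_next /line_rule ci.
have [lt|ge] := boolP ((i - 1 < o)%R || (o + (size w.1.1)%:Z <= i - 1)%R).
  by rewrite (out _ lt).
have iE : i = (o + (size w.1.1)%:Z)%R.
  move: iout ge => /orP[lt|le]; rewrite negb_or => /andP[ge1 ge2]; first by lia.
  by lia.
case: w wfw {al okc} mc mc' nh out {no} sz iout ge iE => [[u p] h] [/= lp cu
  fu] mc mc' nh out sz iout ge iE.
rewrite (_ : (i - 1)%R = (o + (size u).-1%:Z)%R); last by lia.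
rewrite mc /=; last by lia.
case: ifP => // /and3P[_ + _]; rewrite /here /cell_at /c_hd /=.
have -> : ((size u).-1 < p) = false by lia.
case: eqP => // pE _; move: iout; rewrite /word_next (negPf nh) -pE eqxx.
by case: head_step => [[h' s'] m] /=; rewrite size_rcons size_set_nth; lia.
Qed.

(** * Death of the leftmost origin *)

Lemma extract_word o l c : is_orig (c o) ->
  (forall j, j <= l -> ok_at c (o + j%:Z)%R) ->
  (forall j, j <= l -> exists2 a, c (o + j%:Z)%R = Some a & c_end a = (j == l))
    ->
  (forall i, (i < o)%R -> ~~ is_orig (c i)) ->
  exists2 w, wf w & size w.1.1 = l.+1 /\ matches o w c.
Proof.
move=> co okc endc no.
have o0 : (o + 0%:Z)%R = o by lia.
have [a0 ca0 _] := endc 0 (leq0n _).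
pose a j : cell := if c (o + j%:Z)%R is Some b then b else a0.
have aE j : j <= l -> c (o + j%:Z)%R = Some (a j).
  by move=> /endc[b cb _]; rewrite /a cb.
have aend j : j <= l -> c_end (a j) = (j == l).
  by move=> jl; have [b + <-] := endc j jl; rewrite aE // => -[->].
have orig0 : c_orig (a 0) by move: co; rewrite -[o in is_orig (c o)]o0 aE.
have aok j (jl : j <= l) := okc j jl.
have leftE j : j < l -> c (o + j.+1%:Z - 1)%R = Some (a j).
  by move=> jl; rewrite -aE ?(ltnW jl) //; congr c; lia.
have lnk j : j < l -> link (a j) (a j.+1).
  move=> jl; have := aok j (ltnW jl);
    rewrite /ok_at aE ?(ltnW jl) // => /and5P[_ + _ _ _].
  rewrite aend ?(ltnW jl) // ltn_eqF //.
  by rewrite (_ : (o + j%:Z + 1)%R = (o + j.+1%:Z)%R) ?aE //; lia.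
have aorig j : j <= l -> c_orig (a j) = (j == 0).
  by case: j => [_|j /lnk /and3P[_ /negPf -> _]] //; rewrite orig0.
have afar j : j <= l -> s_far (c_sym (a j)) = (X <= j).
  elim: j => [_|j IHj jl].
    have := aok 0 (leq0n _); rewrite /ok_at aE // => /and5P[_ _ _ /eqP -> _].
    by rewrite orig0 /= orbF leqNgt X_gt0; apply/negbTE/no; lia.
  have := aok _ jl; rewrite /ok_at aE // => /and5P[_ _ _ /eqP -> _].
  rewrite aorig // leftE // IHj ?(ltnW jl) //=.
  have [ltX|gtX|eqX] := ltngtP X j.+1.
  + by have -> : X <= j by []; rewrite orbT.
  + have -> : (X <= j) = false by lia.
    by rewrite orbF; apply/negbTE/no; lia.
  + by rewrite (_ : (o + j.+1%:Z - X%:Z)%R = o) ?co //; lia.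
have [alast aclean] : ~~ head_right (a l) /\ s_bits (c_sym (a l)) = [ffun=>
  false].
  have := aok l (leqnn _); rewrite /ok_at aE // => /and5P[_ + _ _ _].
  by rewrite aend // eqxx => /and3P[_ ? /eqP].
(* The head is on the first cell that does not claim it to be on the right; links then force every
   later cell to claim it on the left, so it is unique. *)
have exp : exists j, (j <= l) && ~~ head_right (a j) by exists l; rewrite leqnn.
case: (ex_minnP exp) => p /andP[pl hp] pmin.
have lt_p j : j < p -> c_hd (a j) = inr false.
  move=> jp; have : head_right (a j).
    apply/negPn/negP => hj; have := pmin j; rewrite hj andbT.
    by move=> /(_ ltac:(lia)); lia.
  by rewrite /head_right; case: (c_hd (a j)) => // -[].
have [h hE] : exists h, c_hd (a p) = inl h.
  have : here (a p).
    case: p pl hp lt_p {pmin} => [_|p pl] hp lt_p.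
      have := aok 0 (leq0n _); rewrite /ok_at aE // => /and5P[_ _ + _ _].
      rewrite orig0; move: hp; rewrite /head_right /head_left /here.
      by case: c_hd => // -[].
    have /and3P[_ _] := lnk p pl; rewrite {1}/head_right lt_p //=.
    by rewrite (negPf hp) orbF.
  by rewrite /here; case: c_hd => // h _; exists h.
have gt_p j : p < j -> j <= l -> c_hd (a j) = inr true.
  have nr : ~~ head_right (a p) by [].
  elim: j => // j IHj; rewrite ltnS leq_eqVlt => pj jl.
  have {}nr : ~~ head_right (a j).
    case/predU1P: pj => [<-//|pj].
    by rewrite /head_right IHj // ltnW.
  have /and3P[_ _] := lnk j jl; rewrite (negPf nr) /head_left.
  by case: c_hd => // -[].
pose u := mkseq (fun j => c_sym (a j)) l.+1.
have su : size u = l.+1 by rewrite size_mkseq.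
exists (u, p, h); first split.
- by rewrite -/(p < size u) su ltnS.
- by rewrite /clean_end -nth_last su nth_mkseq // aclean.
- by move=> j; rewrite su ltnS => jl; rewrite nth_mkseq ?ltnS // afar.
split=> // j; rewrite -[_ < _]/(j < size u) su ltnS => jl; rewrite aE //;
  congr Some.
rewrite /cell_at su nth_mkseq ?ltnS //= -aorig // -aend //.
have -> : (if j < p then inr false else if j == p then inl h else inr true) =
  c_hd (a j).
  by case: ltngtP => [/lt_p|pj|->] //; rewrite gt_p.
by case: (a j) => -[[? ?] ?] ?.
Qed.

Lemma c_end_new l a r :
  c_end (new_cell l a r) = c_end a && ~~ here a.
Proof. by []. Qed.

Definition not_end (c : line) i := if c i is Some a then ~~ c_end a else true.

Lemma not_end_next c i : not_end c i -> not_end c (i - 1)%R ->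
  not_end (line_next c) i.
Proof.
rewrite /not_end /line_next /line_rule; case: (c i) => [a|_].
  by case: ifP => // _; rewrite c_end_new => /negPf ->.
by case: (c (i - 1)%R) => // b /negPf ->.
Qed.

(** The gap moves left at each step until it reaches [o]: the cell before it is not an end and lacks
    its right link, and an empty cell is filled only next to an end. *)
Lemma broken_dies l c o : (forall j, j < l -> not_end c (o + j%:Z)%R) ->
  c (o + l%:Z)%R = None -> exists t, ~~ is_orig (iter t line_next c o).
Proof.
have o0 : (o + 0%:Z)%R = o by lia.
elim: l c => [|l IHl] c ne cN; first by exists 0; rewrite /= -o0 cN.
have [co|] := boolP (is_orig (c o)); last by exists 0.
have ne' j : j < l.+1 -> not_end (line_next c) (o + j%:Z)%R.
  case: j => [|j] jl; last first.
    apply: not_end_next; first exact: ne.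
    by rewrite (_ : (_ - 1)%R = (o + j%:Z)%R); [apply: ne; lia|lia].
  have := ne 0 jl; rewrite !o0 /not_end /line_next /line_rule.
  by case: (c o) co => // a _; case: ifP => // _;
    rewrite c_end_new => /negPf ->.
have [||t tE] := IHl (line_next c); last by exists t.+1; rewrite iterSr.
  by move=> j jl; apply: ne'; rewrite ltnW.
have := ne l (ltnSn l); rewrite /line_next /line_rule /not_end.
case cl: (c (o + l%:Z)%R) => [a|] => [/negPf ea|_].
  rewrite /cell_ok ea (_ : (o + l%:Z + 1)%R = (o + l.+1%:Z)%R); last by lia.
  by rewrite cN andbF.
case: l ne cl {IHl ne' cN} => [|l] ne cl; first by rewrite o0 in cl;
  rewrite cl in co.
rewrite (_ : (o + l.+1%:Z - 1)%R = (o + l%:Z)%R); last by lia.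
by have := ne l; rewrite /not_end; case: (c _) => // b /(_ ltac:(lia))/negPf ->.
Qed.

(** Consider the first position that is inconsistent or an end; the bound [b] makes one exist. If it
    is inconsistent, its cell dies and [broken_dies] carries the gap to the origin. *)
Lemma surviving_segment c o b : (forall i, (b < i)%R -> c i = None) ->
  (forall t, is_orig (iter t line_next c o)) -> exists l,
    (forall j, j <= l -> ok_at c (o + j%:Z)%R) /\
    (forall j, j <= l -> exists2 a, c (o + j%:Z)%R = Some a & c_end a = (j ==
      l)).
Proof.
move=> cb surv; have o0 : (o + 0%:Z)%R = o by lia.
pose stop j := ~~ ok_at c (o + j%:Z)%R || ~~ not_end c (o + j%:Z)%R.
have ex : exists j, stop j.
  exists (`|b - o|%N.+1); rewrite /stop /ok_at cb //; lia.
case: (ex_minnP ex) => l stopl lmin.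
have before j : j < l -> ok_at c (o + j%:Z)%R /\ not_end c (o + j%:Z)%R.
  move=> jl; apply/andP; rewrite -[_ && _]negbK negb_and; apply/negP => /lmin;
    lia.
have [okl|nokl] := boolP (ok_at c (o + l%:Z)%R).
  move: stopl; rewrite /stop okl /= => endl; exists l; split=> j jl.
    by move: jl; rewrite leq_eqVlt => /predU1P[->|/before[]].
  move: jl; rewrite leq_eqVlt => /predU1P[->|jl].
    by move: endl; rewrite /not_end eqxx; case: (c _) => // a /negPn ea;
      exists a.
  have [+ +] := before j jl; rewrite /ok_at /not_end.
  case: (c (o + j%:Z)%R) => // a _ ea; exists a => //.
  by rewrite ltn_eqF // (negPf ea).
exfalso; have [||t /negP[]] := @broken_dies l (line_next c) o; last first.
- by rewrite -iterSr; apply: surv.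
- apply: line_next_nok nokl; case: l before {stopl lmin} => [|l] before.
    by have := surv 0; rewrite o0 /=; case: (c o).
  have [+ +] := before l (ltnSn l); rewrite /ok_at /not_end.
  case: (c (o + l%:Z)%R) => // a /and5P[_ right_ok _ _ _] /negPf ea.
  move: right_ok; rewrite ea (_ : (o + l%:Z + 1)%R = (o + l.+1%:Z)%R);
    last by lia.
  by case: (c (o + l.+1%:Z)%R).
- move=> j jl; have [/line_next_ok[a ca nE] +] := before j jl.
  by rewrite /not_end ca nE c_end_new => /negPf ->.
Qed.

Lemma right_bound_next c b : (forall i, (b < i)%R -> c i = None) ->
  forall i, (b + 1 < i)%R -> line_next c i = None.
Proof.
by move=> cb i lt; rewrite /line_next /line_rule !cb //; lia.
Qed.

Lemma iter_orig t c i : is_orig (iter t line_next c i) -> is_orig (c i).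
Proof. by elim: t => //= t IHt /line_next_orig. Qed.

(** If [o] survived, it would begin a consistent segment at every time, and the word read off at
    time 0 would be simulated forever without halting. *)
Lemma origin_dies c o b : (forall w, wf w -> eventually_halts X w) ->
  (forall i, (b < i)%R -> c i = None) ->
  (forall i, (i < o)%R -> ~~ is_orig (c i)) ->
  exists t, ~~ is_orig (iter t line_next c o).
Proof.
move=> halts cb no; apply: contrapT => never.
have surv t : is_orig (iter t line_next c o).
  by apply/negPn/negP => dead; apply: never; exists t.
have bound t : exists b', forall i, (b' < i)%R -> iter t line_next c i = None.
  elim: t => [|t [b' IHt]]; first by exists b.
  by exists (b' + 1)%R => i /=; apply: right_bound_next.
have seg t : exists l,
    (forall j, j <= l -> ok_at (iter t line_next c) (o + j%:Z)%R) /\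
    (forall j, j <= l -> exists2 a, iter t line_next c (o + j%:Z)%R = Some a
       & c_end a = (j == l)).
  have [b' cb'] := bound t; apply: surviving_segment cb' _ => t'.
  by rewrite -iterD.
have no' t i : (i < o)%R -> ~~ is_orig (iter t line_next c i).
  by move=> /no; apply: contra; apply: iter_orig.
have [l0 [ok0 end0]] := seg 0.
have [w wfw [_ mw]] := extract_word (surv 0) ok0 end0 no.
have step t : matches o (iter t word_next w) (iter t line_next c) ->
    ~~ halting (iter t word_next w) /\
    matches o (iter t.+1 word_next w) (iter t.+1 line_next c).
  move=> m; have [wft _ _] := iter_nextP t wfw; have [l [okl endl]] := seg t.
  apply: (matches_next wft m) (no' t) => j lj; apply: okl.
  move: m wft lj; case: (iter t word_next w) => [[u p] h] m [/= lp _ _] lj.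
  (* The word does not extend beyond the segment: an end mark inside the word is its last cell. *)
  rewrite leqNgt; apply/negP => gt; have [a] := endl l (leqnn l).
  rewrite m /=; last by lia.
  by case=> <-; rewrite c_end_at eqxx /= => /eqP; lia.
have main t : matches o (iter t word_next w) (iter t line_next c).
  by elim: t => // t /step[].
have [m hm] := halts w wfw; have [/negP] := step m (main m); by [].
Qed.

(** * Extinction of the line *)

Definition supported (a b : int) (c : line) :=
  forall i, (i < a)%R || (b < i)%R -> c i = None.

Lemma supported_next a b c : supported a b c ->
  supported a (b + 1)%R (line_next c).
Proof.
move=> sc i iab; rewrite /line_next /line_rule !sc //.
  by case/orP: iab => lt; apply/orP; [left|right]; lia.
by case/orP: iab => lt; apply/orP; [left|right]; lia.
Qed.

Lemma supported_iter a b c t : supported a b c ->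
  exists b', supported a b' (iter t line_next c).
Proof.
move=> sc; elim: t => [|t [b' IHt]]; first by exists b.
by exists (b' + 1)%R; apply: supported_next.
Qed.

(** Once no origin is left before [a + n], one at [a + n] is leftmost and dies. Origins are never
    created, so only the positions of the initial support have to be treated. *)
Lemma all_origins_die a b c : (forall w, wf w -> eventually_halts X w) ->
  supported a b c -> exists t, forall i, ~~ is_orig (iter t line_next c i).
Proof.
move=> halts sc.
have left_die n : exists t, forall i, (i < a + n%:Z)%R ->
  ~~ is_orig (iter t line_next c i).
  elim: n => [|n [t IHn]].
    by exists 0 => i lt /=; rewrite sc //; apply/orP; left; lia.
  have [b' sc'] := supported_iter t sc.
  have [||t' dies] := @origin_dies (iter t line_next c) (a + n%:Z)%R b' halts.
  - by move=> i lt; apply: sc'; rewrite lt orbT.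
  - exact: IHn.
  exists (t' + t) => i lt; rewrite iterD.
  have [-> //|ne] := eqVneq i (a + n%:Z)%R.
  apply: contra (IHn i _); last by lia.
  exact: iter_orig.
have [t left_dies] := left_die (`|b - a|%N.+1); exists t => i.
have [lt|ge] := boolP (i < a + (`|b - a|%N.+1)%:Z)%R; first exact: left_dies.
apply/negP => /iter_orig; rewrite sc //; apply/orP; right; lia.
Qed.

Lemma supported_orphans a b c : (forall i, ~~ is_orig (c i)) ->
  supported a b c ->
  supported (a + 2)%R (b + 1)%R (line_next c).
Proof.
move=> no sc i iab; have out j : (j < a)%R || (b < j)%R ->
  c j = None by apply: sc.
case/orP: iab => lt; last first.
  by rewrite /line_next /line_rule !out //; apply/orP; right; lia.
rewrite /line_next /line_rule; have ll : c (i - 2)%R = None by apply: out;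
  apply/orP; left; lia.
rewrite ll; case ci : (c i) => [d|].
  rewrite /cell_ok; have := no i; rewrite ci /= => /negPf ->.
  case cl : (c (i - 1)%R) => [e|] //=.
  by have := no (i - 1)%R; rewrite cl /= => /negPf ->; rewrite andbF.
case cl : (c (i - 1)%R) => [e|] //=.
by have := no (i - 1)%R; rewrite cl /= => /negPf ->; rewrite !andbF.
Qed.

Lemma line_dies a b c : (forall w, wf w -> eventually_halts X w) ->
  supported a b c -> exists t, forall i, iter t line_next c i = None.
Proof.
move=> halts sc; have [t no] := all_origins_die halts sc.
have [b' sc'] := supported_iter t sc; set c' := iter t _ _ in no sc'.
have shrink n : supported (a + (n.*2)%:Z)%R (b' + n%:Z)%R (iter n line_next c').
  elim: n => [|n IHn]; first by move=> i lt; apply: sc'; move: lt;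
    rewrite double0 !GRing.addr0.
  have no' i : ~~ is_orig (iter n line_next c' i).
    by apply: contra (no i); apply: iter_orig.
  by move=> i lt; apply: (supported_orphans no' IHn); case/orP: lt => lt;
    apply/orP; [left|right]; lia.
exists (`|b' - a|%N.+1 + t) => i; rewrite iterD; apply: shrink; lia.
Qed.

(** * An immortal line *)

Definition initial_line (y : nat) : line := fun i =>
  if i is Posz j then
    if j < X + y.+1 then Some (cell_at ([seq (X <= k, k < y, false, [ffun=>
      false]) |
      k <- iota 0 (X + y.+1)], 0, (None, Some (false, false))) j)
    else None
  else None.

Lemma line_survives y : 1 < K -> all (fun i => op_below K i.1.1) P ->
  (forall n, (iter n (run1 P) (0, search_store X y)).1 < size P) ->
  supported 0%R (X + y)%:Z (initial_line y) /\
  forall t, exists i, iter t line_next (initial_line y) i <> None.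
Proof.
move=> K_gt1 P_below runs; split.
  by case=> j lt //; rewrite /initial_line ifF //; case/orP: lt; lia.
pose u : seq sym := [seq (X <= k, k < y, false, [ffun=> false]) | k <- iota 0
  (X + y.+1)].
have su : size u = X + y.+1 by rewrite size_map size_iota.
have uE k : k < X + y.+1 -> nth (blank_sym false) u k = (X <= k, k < y, false,
  [ffun=> false]).
  by move=> lk; rewrite (nth_map 0) ?size_iota // nth_iota.
have wfu : wf (base u None).
  split=> /=; first by lia.
  - by rewrite /clean_end -nth_last su uE //; lia.
  - by move=> j; rewrite su => lj; rewrite uE.
have yu : yc u = y.
  rewrite /yc -(sum_ltn (m := y) (n := X + y.+1)); last by lia.
  rewrite count_map -sum1_count big_mkcond /= -[in LHS](subn0 (X + y.+1)).
  rewrite -[iota _ _]/(index_iota 0 (X + y.+1)) big_mkord.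
  by apply: eq_bigr => i _; rewrite /s_y /=; case: ifP.
have nh t := word_survives K_gt1 P_below runs t wfu yu.
have al0 : alone 0%R (base u None) (initial_line y).
  split=> [j|]; first by rewrite su => lj; rewrite GRing.add0r /= lj.
  case=> j //; rewrite su GRing.add0r /= => lt; rewrite ifF //; lia.
move=> t; exists 0%R.
have al : alone 0%R (iter t word_next (base u None)) (iter t line_next
  (initial_line y)).
  elim: t => // t IHt; have [wft _ _] := iter_nextP t wfu.
  exact: alone_next wft IHt (nh t).
have [[lp _ _] _ _] := iter_nextP t wfu.
have [mt _] := al; have := mt 0; rewrite GRing.addr0 => -> //.
exact: leq_ltn_trans lp.
Qed.
End LineDynamics.

(** * Reduction *)

Local Open Scope classical_set_scope.

Section Embedding.
Variables (P : seq instr) (K d x : nat).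

Local Notation cell := (cell P K).
Local Notation X := (x + 3).
Local Notation state := 'I_#|{: cell}|.+1.

Definition encode (a : option cell) : state :=
  if a is Some a then lift ord0 (enum_rank a) else ord0.

Definition decode (s : state) : option cell := omap enum_val (unlift ord0 s).

Lemma encodeK : cancel encode decode.
Proof.
by rewrite /decode => -[a|] /=; rewrite ?liftK ?unlift_none //= enum_rankK.
Qed.

Lemma decode_None s : decode s = None -> s = ord0.
Proof. by rewrite /decode; case: unliftP. Qed.

Definition axis (i : int) : 'rV[int]_d.+1
  := \row_j (if j == ord0 then i else 0%R).

Lemma axisD i j : axis (i + j)%R = (axis i + axis j)%R.
Proof. by apply/rowP => k; rewrite !mxE; case: ifP; rewrite ?addr0. Qed.

Lemma axis0 : axis 0%R = 0%R.
Proof. by apply/rowP => k; rewrite !mxE; case: ifP. Qed.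

Lemma axis_inj : injective axis.
Proof. by move=> i j /rowP/(_ ord0); rewrite !mxE. Qed.

(** As [X] is at least 3, the last offset differs from the others; this is why the machine is given
    [x + 3]. *)
Definition offsets : seq int := [:: -2; -1; 0; 1; - X%:Z]%R.

Definition nbhd := [seq axis i | i <- offsets].

Lemma nbhd_uniq : uniq nbhd.
Proof.
rewrite (map_inj_uniq axis_inj) /= !inE !negb_or; lia.
Qed.

Definition automaton_rule (g : nat -> state) : state :=
  encode (line_rule (decode (g 0)) (decode (g 1)) (decode (g 2)) (decode (g 3))
            (decode (g 4))).

Lemma eq_automaton_rule g g' : (forall i, i < 5 -> g i = g' i) ->
  automaton_rule g = automaton_rule g'.
Proof. by move=> e; rewrite /automaton_rule !e. Qed.

Definition automaton_ffun : {ffun {ffun seq_sub nbhd -> state} -> state} :=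
  [ffun p : {ffun seq_sub nbhd -> state} => automaton_rule (fun i =>
     if insub (nth 0%R nbhd i) is Some v then p v else ord0)].

Lemma automaton_quiescent : automaton_ffun [ffun=> ord0] = ord0.
Proof.
rewrite ffunE (@eq_automaton_rule _ (fun=> ord0)) => [|i _]; last first.
  by case: insub => // v; rewrite ffunE.
by rewrite /automaton_rule /decode unlift_none.
Qed.

Definition automaton : cellular_automaton d.+1 :=
  CellularAutomaton nbhd_uniq automaton_quiescent.

Definition line_of (c : configuration automaton) v : line P K :=
  fun i => decode (c (v + axis i)%R).

Lemma line_of_global c v : line_of (ca_global c) v = line_next X (line_of c v).
Proof.
apply: funext => i; rewrite /line_of /ca_global ffunE.
rewrite (@eq_automaton_rule _ (fun k => c (v + axis (i + nth 0%R offsets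
  k))%R)).
  by rewrite /automaton_rule encodeK /= !addr0.
move=> k k5; have kN : nth 0%R nbhd k \in nbhd by rewrite mem_nth.
by rewrite insubT ffunE /= (nth_map 0%R) // axisD addrA.
Qed.

Lemma line_of_iter c v t : line_of (iter t (@ca_global _ automaton) c) v =
  iter t (line_next X) (line_of c v).
Proof. by elim: t => //= t IHt; rewrite line_of_global IHt. Qed.

Lemma iter_line_next0 (c : line P K) t t' : (forall i, iter t (line_next X) c i
  = None) ->
  t <= t' -> forall i, iter t' (line_next X) c i = None.
Proof.
move=> c0 /subnK <-; rewrite iterD (_ : iter t _ _ = fun=> None);
  last exact: funext.
by elim: (t' - t) => //= n IHn i; rewrite (_ : iter n _ _ = fun=> None) //;
  apply: funext.
Qed.

(** A finite configuration meets finitely many lines, which have a common time of death; all other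
    lines are empty from the start. *)
Lemma automaton_nilpotent :
  (forall a b c, supported a b c ->
    exists t, forall i, iter t (@line_next P K X) c i = None) ->
  nilpotent_on_finite automaton.
Proof.
move=> dies c /finite_seqP[s sE].
have csupp v : c v <> ord0 -> v \in s by move=> cv;
  have : [set` s] v by rewrite -sE.
have bounded v : exists B : nat, supported (- B%:Z)%R B%:Z (line_of c v).
  exists (\max_(w <- s) `|(w - v)%R ord0 ord0|%N) => i out.
  rewrite /line_of; have [-> |/eqP/csupp vs] := eqVneq (c (v + axis i)%R) ord0.
    by rewrite /decode unlift_none.
  have : `|i| <= \max_(w <- s) `|(w - v)%R ord0 ord0|%N.
    by rewrite (big_rem _ vs) /= [(v + _ - v)%R]addrC addKr mxE /= leq_maxl.
  by move: out; lia.
have [T dead] : exists T, forall v, v \in s -> forall i,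
    iter T (line_next X) (line_of c v) i = None.
  elim: (s) => [|v s' [T IHs]]; first by exists 0.
  have [B /dies[t tv]] := bounded v; exists (maxn t T) => w; rewrite inE.
  by case/predU1P=> [->|/IHs]; [move: tv|]; move/iter_line_next0; apply;
    rewrite ?leq_maxl ?leq_maxr.
exists T => u; apply: decode_None.
rewrite -[u in iter _ _ _ u]addr0 -axis0 -[decode _]/(line_of _ u 0%R)
  line_of_iter.
have [[i us]|none] := pselect (exists i, (u + axis i)%R \in s).
  have := dead _ us (- i)%R; rewrite -!line_of_iter /line_of.
  by rewrite -addrA -axisD addrN.
apply: (@iter_line_next0 _ 0) => // i; rewrite /= /line_of.
have [->|/eqP/csupp us] := eqVneq (c (u + axis i)%R) ord0.
  by rewrite /decode unlift_none.
by case: none; exists i.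
Qed.

Lemma automaton_not_nilpotent (c : line P K) a b : supported a b c ->
  (forall t, exists i, iter t (line_next X) c i <> None) ->
  ~ nilpotent_on_finite automaton.
Proof.
move=> supp alive nil.
pose cc : configuration automaton := fun v =>
  if v == axis (v ord0 ord0) then encode (c (v ord0 ord0)) else ord0.
have line_c : line_of cc 0%R = c.
  apply: funext => i; rewrite /line_of /cc add0r.
  have -> : axis i ord0 ord0 = i by rewrite mxE eqxx.
  by rewrite eqxx encodeK.
have [|n c0] := nil cc.
  apply: (@sub_finite_set _ _ [set axis (a + k%:Z)%R | k in `I_(`|b - a|.+1)]).
    move=> v /=; rewrite /cc; case: eqP => // vE cv.
    have [out|] := boolP ((v ord0 ord0 < a)%R || (b < v ord0 ord0)%R).
      by rewrite supp in cv.
    rewrite negb_or => /andP[ge le]; exists `|v ord0 ord0 - a|%N;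
      first by rewrite /=; lia.
    by rewrite [RHS]vE; congr axis; lia.
  exact/finite_image/finite_II.
have [i] := alive n; apply.
rewrite -line_c -line_of_iter /line_of c0.
by rewrite /decode unlift_none.
Qed.

End Embedding.

Lemma axis_code d i : vector_code (axis d i) = CodeSeq.code (int_code i :: nseq
  d 0).
Proof.
congr CodeSeq.code; rewrite enum_ordSl /= mxE eqxx; congr (_ :: _).
rewrite -map_comp (@eq_map _ _ _ (fun=> 0)) => [|j /=]; last by rewrite mxE.
by rewrite -[in RHS](size_enum_ord d); elim: (enum _) => //= _ js ->.
Qed.

(** Independent of [x], hence a mere constant in the computation of [automaton_code]. *)
Definition automaton_table P K : seq nat :=
  [seq (automaton_rule (fun i => inord (j %/ #|{: cell P K}|.+1 ^ i %% #|{: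
    cell P K}|.+1)
     : 'I_#|{: cell P K}|.+1) : nat)
  | j <- iota 0 (#|{: cell P K}|.+1 ^ 5)].

Definition automaton_code P K d x := CodeSeq.code [:: #|{: cell P K}|.+1;
  CodeSeq.code [seq CodeSeq.code (int_code i :: nseq d 0) | i <- offsets x];
  CodeSeq.code (automaton_table P K)].

Lemma ca_code_automaton P K d x :
  ca_code (automaton P K d x) = automaton_code P K d x.
Proof.
rewrite /ca_code /automaton_code; congr (CodeSeq.code [:: _; CodeSeq.code _;
  CodeSeq.code _]).
  by rewrite -map_comp; apply: eq_map => i /=; rewrite axis_code.
rewrite /rule_table; apply: eq_map => j /=; rewrite ffunE; congr nat_of_ord.
apply: eq_automaton_rule => i i5.
have iN : nth 0%R (nbhd d x) i \in nbhd d x by rewrite mem_nth.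
by rewrite insubT ffunE SubK index_uniq ?nbhd_uniq.
Qed.

Lemma cmp_code_cons n F (S : (nat -> nat) -> seq nat) : cmp n F ->
  cmp n (fun rho => CodeSeq.code (S rho)) ->
  cmp n (fun rho => CodeSeq.code (F rho :: S rho)).
Proof.
move=> cF cS; rewrite /CodeSeq.code /= -/(CodeSeq.code _).
by repeat cmp_basic.
Qed.

Lemma automaton_code_computable P K d : computable_fun (automaton_code P K d).
Proof.
apply: cmp_computable_fun; rewrite /automaton_code.
have cC c : cmp 1 (fun=> c) by apply: cmp_const.
have cZ k : cmp 1 (fun rho => CodeSeq.code (int_code (- (rho 0 + 3)%:Z)%R ::
  nseq k 0)).
  apply: (@cmp_code_cons _ (fun rho => int_code (- (rho 0 + 3)%:Z)%R)
    (fun=> nseq k 0)) (cC _).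
  apply: (@eq_cmp _ (fun rho => (rho 0 + 2).*2.+1)); last by repeat cmp_basic.
  by move=> rho; rewrite [rho 0 + 3]addnS.
pose c i := CodeSeq.code (int_code i :: nseq d 0).
pose far (rho : nat -> nat) := c (- (rho 0 + 3)%:Z)%R.
pose N rho := CodeSeq.code [:: c (- 2)%R; c (- 1)%R; c 0%R; c 1%R; far rho].
have cN : cmp 1 N.
  apply: (@cmp_code_cons _ _ (fun rho => [:: c (- 1)%R; c 0%R; c 1%R;
    far rho]) (cC _)).
  apply: (@cmp_code_cons _ _ (fun rho => [:: c 0%R; c 1%R; far rho]) (cC _)).
  apply: (@cmp_code_cons _ _ (fun rho => [:: c 1%R; far rho]) (cC _)).
  apply: (@cmp_code_cons _ _ (fun rho => [:: far rho]) (cC _)).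
  exact: (@cmp_code_cons _ _ (fun=> [::]) (cZ d) (cC _)).
apply: (@cmp_code_cons _ _ (fun rho => [:: N rho; _]) (cC _)).
exact: (@cmp_code_cons _ _ (fun=> [:: _]) cN (cC _)).
Qed.

Theorem corollary1 (d : nat) (d_ge1 : 1 <= d) :
  Pi02_complete (nilpotent_ca_codes d).
Proof.
split; first exact: Pi02_nilpotent_ca_codes.
case: d d_ge1 => // d _ A [R /computable_rel3_cmp cR AR].
(* The machine receives [x + 3], so [R] is shifted back. *)
have cR' : cmpb 3 (fun rho => R (rho 0 - 3) (rho 1) (rho 2)).
  apply: (cmp_comp (G := fun i rho => if i == 0 then rho 0 - 3 else rho i) cR).
  by case=> [|[|[|//]]] _ /=; repeat cmp_basic.
have [P PR] := search_program (R := fun x y z => R (x - 3) y z) cR'.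
have [K K_gt1 P_below] := program_below P.
exists (automaton_code P K d); first exact: automaton_code_computable.
move=> x; have X_gt0 : 0 < x + 3 by rewrite addn3.
split=> [Ax|[B BE]].
  exists (automaton P K d x); first exact: ca_code_automaton.
  apply: automaton_nilpotent => a b c; apply: line_dies => // w.
  apply: word_halts => // y; have [halts _] := PR (x + 3) y; apply: halts.
  by have [z Rz] := (AR x).1 Ax y; exists z; rewrite addnK.
(* Some automaton with this code is nilpotent; as codes are injective, it is the one constructed. *)
rewrite -ca_code_automaton in BE; rewrite (ca_code_inj BE) => nil.
apply/AR => y; apply: contrapT => noz.
have [|supp alive] := @line_survives P K (x + 3) X_gt0 y K_gt1 P_below;
  last first.
  exact: automaton_not_nilpotent supp alive nil.
have [_ runs] := PR (x + 3) y; apply: runs => z; rewrite addnK.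
by apply/negP => Rz; apply: noz; exists z.
Qed.
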